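(* Let $n \geq 2$ and let $M^n$ be a closed, connected and oriented immersed hypersurface of $\mathbb{S}^{n+1}$ with unit normal $\eta : M \to \mathbb{S}^{n+1}$. Suppose that there exists a point $p_0 \in \mathbb{S}^{n+1}$ such that the spherical image $\eta(M)$ lies in the strip of width $L \in [0,\pi/2]$ around the totally geodesic hypersphere $T = \{x \in \mathbb{S}^{n+1} : \langle x, p_0\rangle = 0\}$ determined by $p_0$, that is, $d(\eta(p), T) \le L$ for all $p \in M$, and that $M$ is contained in the geodesic ball of radius $R \in (0,\pi)$ centered at $p_0$. If the principal curvatures $\lambda_1,\dots,\lambda_n$ of $M$ satisfy $$\inf_{p \in M} |\lambda_i(p)| > \frac{\sin L}{1 + \cos R}, \quad \forall\, i \in \{1,\dots,n\},$$ then $M$ is diffeomorphic to a sphere.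
   Context: $\mathbb{S}^{n+1} \subset \mathbb{R}^{n+2}$ is the unit sphere with its round metric of constant curvature $1$, $\langle\cdot,\cdot\rangle$ is the Euclidean inner product and $d$ the geodesic distance on $\mathbb{S}^{n+1}$. Closed means compact without boundary. The unit normal $\eta(p) \in T_p\mathbb{S}^{n+1}$ at $p\in M$ is viewed as a point of $\mathbb{S}^{n+1}$ (the usual Gauss map). The geodesic ball of radius $R$ centered at $p_0$ is $\{x : d(x,p_0) \le R\}$. The principal curvatures at $p$ are the eigenvalues of the shape operator $A_p(v) = -\overline{\nabla}_v \eta$, where $\overline{\nabla}$ is the Riemannian connection of $\mathbb{S}^{n+1}$. *)

(* Defs.v *)
From HB Require Import structures.
From mathcomp Require Import all_boot all_order all_algebra.
From mathcomp Require Import all_classical all_reals all_analysis.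
From mathcomp Require Import ring lra.

Set Implicit Arguments.
Unset Strict Implicit.
Unset Printing Implicit Defensive.

Import Order.TTheory GRing.Theory Num.Theory.
Import numFieldNormedType.Exports.

Local Open Scope classical_set_scope.
Local Open Scope ring_scope.

Section smooth_functions.
Context {R : realType}.

(* Meant for an open set U. *)
Fixpoint Ck (k : nat) m (U : set 'rV[R]_m) (f : 'rV[R]_m -> R) : Prop :=
  (forall u, U u -> {for u, continuous f}) /\
  if k is k'.+1 then
    forall i : 'I_m, (forall u, U u -> derivable f u (delta_mx 0 i)) /\
                     Ck k' U ('D_(delta_mx 0 i) f)
  else True.

Definition smooth_on m q (U : set 'rV[R]_m) (f : 'rV[R]_m -> 'rV[R]_q) : Prop :=
  forall k (j : 'I_q), Ck k U (fun u => f u 0 j).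

Lemma Ck_cont k m (U : set 'rV[R]_m) f : Ck k U f ->
  forall u, U u -> {for u, continuous f}.
Proof. by case: k => [|k] []. Qed.

Lemma CkS k m (U : set 'rV[R]_m) f : Ck k.+1 U f -> Ck k U f.
Proof.
elim: k f => [|k IH] f; first by case.
move=> [cf df]; split => // i; have [d1 d2] := df i.
by split => //; exact: IH.
Qed.

Lemma CkT k m (U : set 'rV[R]_m) f : Ck k setT f -> Ck k U f.
Proof.
elim: k f => [|k IH] f [cf df]; split=> [u _|] //; try exact: cf.
move=> i; have [d1 d2] := df i; split=> [u _|]; [exact: d1|exact: IH].
Qed.

Lemma near_eq_continuous_at (T S : topologicalType) (f g : T -> S) (t : T) :
  (\near t, f t = g t) -> {for t, continuous f} -> {for t, continuous g}.
Proof.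
move=> fg; rewrite /prop_for /continuous_at -(nbhs_singleton fg).
by apply: cvg_trans; exact: near_eq_cvg.
Qed.

Lemma eq_Ck k m (U : set 'rV[R]_m) f g : open U ->
  (forall u, U u -> f u = g u) -> Ck k U f -> Ck k U g.
Proof.
move=> oU; elim: k f g => [|k IH] f g fg.
all: have fgn u : U u -> \forall v \near u, f v = g v
  by move=> Uu; apply: filterS (open_nbhs_nbhs (conj oU Uu)) => v /fg.
  case=> cf _; split => // u Uu.
  exact: near_eq_continuous_at (fgn u Uu) (cf u Uu).
move=> [cf df]; split=> [u Uu|i].
  exact: near_eq_continuous_at (fgn u Uu) (cf u Uu).
have [d1 d2] := df i; split=> [u Uu|].
  by apply: (near_eq_derivable (fgn u Uu)); exact: d1.
apply: IH d2 => u Uu.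
by apply: near_eq_derive; exact: fgn.
Qed.

Lemma Ck_cst k m (U : set 'rV[R]_m) (a : R) : Ck k U (cst a).
Proof.
elim: k a => [|k IH] a; split => //; try by move=> u _; exact: cst_continuous.
move=> i; split=> [u _|]; first exact: derivable_cst.
suff -> : 'D_(delta_mx 0 i) (cst a : 'rV[R]_m -> R) = cst 0 by exact: IH.
by apply/funext => u; rewrite derive_cst.
Qed.

Lemma Ck_coord k m (U : set 'rV[R]_m) j : Ck k U (fun u => u 0 j).
Proof.
case: k => [|k]; split => //; try by move=> u _; exact: coord_continuous.
move=> i; split=> [u _|]; first exact/diff_derivable/differentiable_coord.
suff -> : 'D_(delta_mx 0 i) (fun u : 'rV[R]_m => u 0 j) =
          cst ((delta_mx 0 i : 'rV[R]_m) 0 j) by exact: Ck_cst.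
apply/funext => u /=.
have idu : derivable (@id 'rV[R]_m) u (delta_mx 0 i) by exact: derivable_id.
by have := derive_mx idu; rewrite derive_id => /matrixP /(_ 0 j) ->; rewrite mxE.
Qed.

Lemma CkD k m (U : set 'rV[R]_m) f g : open U -> Ck k U f -> Ck k U g ->
  Ck k U (fun u => f u + g u).
Proof.
move=> oU; elim: k f g => [|k IH] f g [cf df] [cg dg]; split => //.
- by move=> u Uu; apply: continuousD; [exact: cf|exact: cg].
- by move=> u Uu; apply: continuousD; [exact: cf|exact: cg].
- move=> i; have [f1 f2] := df i; have [g1 g2] := dg i; split=> [u Uu|].
    by apply: derivableD; [exact: f1|exact: g1].
  apply: eq_Ck (IH _ _ f2 g2) => // u Uu /=.
  by rewrite -deriveD//; [exact: f1|exact: g1].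
Qed.

Lemma CkM k m (U : set 'rV[R]_m) f g : open U -> Ck k U f -> Ck k U g ->
  Ck k U (fun u => f u * g u).
Proof.
move=> oU; elim: k f g => [|k IH] f g kf kg.
  split => // u Uu; apply: continuousM.
    exact: (Ck_cont kf).
  exact: (Ck_cont kg).
have [[cf df] [cg dg]] := (kf, kg); split.
  by move=> u Uu; apply: continuousM; [exact: cf|exact: cg].
move=> i; have [f1 f2] := df i; have [g1 g2] := dg i; split=> [u Uu|].
  by apply: derivableM; [exact: f1|exact: g1].
apply: eq_Ck (CkD oU (IH _ _ (CkS kf) g2) (IH _ _ (CkS kg) f2)) => // u Uu /=.
by rewrite -[RHS]/('D_(delta_mx 0 i) (f * g) u) deriveM//; [exact: f1|exact: g1].
Qed.

Lemma CkV k m (U : set 'rV[R]_m) f : open U -> (forall u, U u -> f u != 0) ->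
  Ck k U f -> Ck k U (fun u => (f u)^-1).
Proof.
move=> oU f0; elim: k => [|k IH] kf.
  by split => // u Uu; apply: continuousV; [exact: f0|exact: (Ck_cont kf)].
have [cf df] := kf; split.
  by move=> u Uu; apply: continuousV; [exact: f0|exact: cf].
move=> i; have [f1 f2] := df i; split=> [u Uu|].
  by apply: derivableV; [exact: f0|exact: f1].
have kV := IH (CkS kf).
apply: eq_Ck (CkM oU (CkM oU (Ck_cst k U (-1)) (CkM oU kV kV)) f2) => // u Uu /=.
rewrite deriveV//; [|exact: f0|exact: f1].
by rewrite mulN1r -invfM -expr2.
Qed.

Lemma Ck_sum k m (U : set 'rV[R]_m) p (f : 'I_p -> 'rV[R]_m -> R) : open U ->
  (forall j, Ck k U (f j)) -> Ck k U (fun u => \sum_j f j u).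
Proof.
move=> oU kf; elim: p f kf => [|p IH] f kf.
  by apply: eq_Ck (Ck_cst k U 0) => // u _; rewrite big_ord0.
apply: eq_Ck (CkD oU (kf ord0) (IH (fun j => f (lift ord0 j)) _)) => //.
by move=> u _; rewrite big_ord_recl.
Qed.

Lemma eq_smooth_on m q (U : set 'rV[R]_m) (f g : 'rV[R]_m -> 'rV[R]_q) :
  open U -> (forall u, U u -> f u = g u) -> smooth_on U f -> smooth_on U g.
Proof.
by move=> oU fg sf k j; apply: eq_Ck (sf k j) => // u /fg ->.
Qed.

End smooth_functions.

Section manifolds.
Context {R : realType}.

(* The two continuity clauses are pointwise, which is enough since the domain
   and the range are open; outside of the range the value of the inverse is
   irrelevant. *)
Record chart (m : nat) (T : topologicalType) := Chart {
  chart_dom : set T;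
  chart_fun :> T -> 'rV[R]_m;
  chart_inv : 'rV[R]_m -> T;
  chart_dom_open : open chart_dom;
  chart_range_open : open (chart_fun @` chart_dom);
  chart_funK : forall p, chart_dom p -> chart_inv (chart_fun p) = p;
  chart_fun_cont : forall p, chart_dom p -> {for p, continuous chart_fun};
  chart_inv_cont : forall u, (chart_fun @` chart_dom) u ->
    {for u, continuous chart_inv} }.

(* A smooth atlas, not required to be maximal. *)
Record atlas (m : nat) (T : topologicalType) := Atlas {
  charts : set (chart m T);
  charts_cover : forall p, exists2 c, charts c & chart_dom c p;
  charts_compat : forall c d, charts c -> charts d ->
    smooth_on (c @` (chart_dom c `&` chart_dom d)) (d \o chart_inv c) }.

Definition smooth_map m1 m2 (T1 T2 : topologicalType) (A1 : atlas m1 T1)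
    (A2 : atlas m2 T2) (f : T1 -> T2) : Prop :=
  continuous f /\
  forall c d, charts A1 c -> charts A2 d ->
    smooth_on (c @` (chart_dom c `&` f @^-1` chart_dom d))
              (d \o f \o chart_inv c).

Definition diffeomorphic m1 m2 (T1 T2 : topologicalType) (A1 : atlas m1 T1)
    (A2 : atlas m2 T2) : Prop :=
  exists f g, [/\ cancel f g, cancel g f, smooth_map A1 A2 f
                & smooth_map A2 A1 g].

End manifolds.

Section sphere.
Context {R : realType}.

Definition dotr q (u v : 'rV[R]_q) : R := \sum_j u 0 j * v 0 j.

Definition sphere (q : nat) : set 'rV[R]_q.+1 := [set x | dotr x x = 1].
Arguments sphere : clear implicits.

(* Stereographic projection from the pole (s, 0, ..., 0), where s = (-1)^b. *)
Definition stereo q (b : bool) (x : sphere q) : 'rV[R]_q :=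
  let y : 'rV[R]_(1 + q) := val x in
  (1 - (-1) ^+ b * y 0 0)^-1 *: rsubmx y.

Definition stereo_inv_fun q (b : bool) (u : 'rV[R]_q) : 'rV[R]_q.+1 :=
  row_mx ((-1) ^+ b * ((dotr u u - 1) / (dotr u u + 1)))%:M
         ((2 / (dotr u u + 1)) *: u).

Lemma dotr_ge0 q (u : 'rV[R]_q) : 0 <= dotr u u.
Proof. by apply: sumr_ge0 => j _; rewrite -expr2 sqr_ge0. Qed.

Lemma dotr_eq0 q (u : 'rV[R]_q) : dotr u u = 0 -> u = 0.
Proof.
move=> /psumr_eq0P u0; apply/rowP => j; rewrite mxE; apply/eqP.
rewrite -sqrf_eq0 expr2; apply/eqP/u0 => // i _.
by rewrite -expr2 sqr_ge0.
Qed.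

Lemma dotrZ q a (u : 'rV[R]_q) : dotr (a *: u) (a *: u) = a ^+ 2 * dotr u u.
Proof.
by rewrite /dotr mulr_sumr; apply: eq_bigr => j _; rewrite !mxE; ring.
Qed.

Lemma row_mx_head q a (u : 'rV[R]_q) :
  (row_mx (a%:M : 'M[R]_1) u : 'rV[R]_q.+1) 0 0 = a.
Proof.
transitivity (row_mx (a%:M : 'M[R]_1) u 0 (lshift q 0)); last first.
  by rewrite row_mxEl mxE.
by congr (fun_of_matrix _ _ _); exact/val_inj.
Qed.

Lemma row_mx_tail q a (u : 'rV[R]_q) j :
  (row_mx (a%:M : 'M[R]_1) u : 'rV[R]_q.+1) 0 (lift ord0 j) = u 0 j.
Proof.
transitivity (row_mx (a%:M : 'M[R]_1) u 0 (rshift 1 j)); last exact: row_mxEr.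
by congr (fun_of_matrix _ _ _); exact/val_inj.
Qed.

Lemma dotr_row_mx q a (u : 'rV[R]_q) (y : 'rV[R]_q.+1) :
  y = row_mx (a%:M : 'M[R]_1) u -> dotr y y = a ^+ 2 + dotr u u.
Proof.
move=> ->; rewrite /dotr big_ord_recl row_mx_head expr2; congr (_ + _).
by apply: eq_bigr => j _; rewrite row_mx_tail.
Qed.

Lemma row_split q (y : 'rV[R]_q.+1) :
  y = row_mx (y 0 0)%:M (rsubmx (y : 'rV_(1 + q))).
Proof.
apply/rowP => j; case: (unliftP ord0 j) => [i|] ->.
  by rewrite row_mx_tail mxE; congr (y _ _); exact/val_inj.
by rewrite row_mx_head.
Qed.

Lemma stereo_inv_subproof q b (u : 'rV[R]_q) :
  stereo_inv_fun b u \in sphere q.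
Proof.
apply/mem_set; rewrite /sphere /= (dotr_row_mx erefl) dotrZ exprMn sqrr_sign.
have := dotr_ge0 u; set d := dotr u u => d0.
by field; apply: lt0r_neq0; lra.
Qed.

Definition stereo_inv q (b : bool) (u : 'rV[R]_q) : sphere q :=
  exist _ (stereo_inv_fun b u) (stereo_inv_subproof b u).

Definition stereo_dom q (b : bool) : set (sphere q) :=
  [set x | (val x : 'rV[R]_q.+1) 0 0 != (-1) ^+ b].

Lemma stereo_dom_denom q b (x : sphere q) : stereo_dom b x ->
  1 - (-1) ^+ b * (val x : 'rV[R]_q.+1) 0 0 != 0.
Proof.
move=> /eqP xb; apply/eqP => h; apply: xb.
have /(congr1 ( *%R ((-1) ^+ b))) := subr0_eq h.
by rewrite mulr1 mulrA -expr2 sqrr_sign mul1r.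
Qed.

Lemma stereo_invK q b (u : 'rV[R]_q) : stereo b (stereo_inv b u) = u.
Proof.
rewrite /stereo /= /stereo_inv_fun row_mxKr.
rewrite row_mx_head mulrA -expr2 sqrr_sign mul1r scalerA -[RHS]scale1r; congr (_ *: _).
have := dotr_ge0 u; set d := dotr u u => d0.
have d1 : d + 1 != 0 by apply: lt0r_neq0; lra.
by field; rewrite d1 /=; apply: lt0r_neq0; lra.
Qed.

Lemma stereo_inv_dom q b (u : 'rV[R]_q) : stereo_dom b (stereo_inv b u).
Proof.
rewrite /stereo_dom /= /stereo_inv_fun row_mx_head -subr_eq0 -{2}[_ ^+ b]mulr1 -mulrBr.
rewrite mulf_neq0// ?signr_eq0//.
have := dotr_ge0 u; set d := dotr u u => d0.
have d1 : d + 1 != 0 by apply: lt0r_neq0; lra.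
have -> : (d - 1) / (d + 1) - 1 = - 2 / (d + 1) by field.
by rewrite mulf_neq0 ?invr_eq0// oppr_eq0 pnatr_eq0.
Qed.

Lemma stereoK q b (x : sphere q) :
  stereo_dom b x -> stereo_inv b (stereo b x) = x.
Proof.
case: x => y ys /stereo_dom_denom/=; set a := y 0 0; set t := (-1) ^+ b => D0.
have yE := row_split y.
have y1 : a ^+ 2 + dotr (rsubmx (y : 'rV_(1 + q))) (rsubmx (y : 'rV_(1 + q))) = 1.
  by rewrite -(dotr_row_mx yE); exact: (set_mem ys).
have t2 : t ^+ 2 = 1 by rewrite sqrr_sign.
apply: val_inj => /=; rewrite [RHS]yE /stereo /stereo_inv_fun /=.
rewrite -/a -/t dotrZ; set d := _ * dotr _ _.
have dE : d = (1 + t * a) / (1 - t * a).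
  rewrite /d (_ : dotr _ _ = (1 - t * a) * (1 + t * a)).
    by field.
  have -> : (1 - t * a) * (1 + t * a) = 1 - t ^+ 2 * a ^+ 2 by ring.
  by rewrite t2 mul1r; apply: (addrI (a ^+ 2)); rewrite y1; ring.
have dp : d + 1 = 2 / (1 - t * a) by rewrite dE; field.
have dm : d - 1 = 2 * t * a / (1 - t * a) by rewrite dE; field.
have -> : t * ((d - 1) / (d + 1)) = a.
  rewrite dp dm; transitivity (t ^+ 2 * a); last by rewrite t2 mul1r.
  by field.
suff -> : (2 / (d + 1)) *: ((1 - t * a)^-1 *: rsubmx (y : 'rV_(1 + q))) =
  rsubmx (y : 'rV_(1 + q)) by [].
rewrite scalerA dp -[RHS]scale1r; congr (_ *: _).
by field.
Qed.

Lemma stereo_range q b : @stereo q b @` stereo_dom b = setT.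
Proof.
apply/seteqP; split => // u _; exists (stereo_inv b u).
  exact: stereo_inv_dom.
exact: stereo_invK.
Qed.

Lemma sphere_coord_cont q j :
  continuous (fun x : sphere q => (val x : 'rV[R]_q.+1) 0 j).
Proof.
move=> x.
have cv : {for x, continuous (set_val : sphere q -> 'rV[R]_q.+1)}.
  exact: initial_continuous.
exact: (continuous_comp cv (@coord_continuous _ _ _ 0 j _)).
Qed.

Lemma cvg_rV (T : topologicalType) q (f : T -> 'rV[R]_q) (t : T) :
  (forall j, {for t, continuous (fun s => f s 0 j)}) -> {for t, continuous f}.
Proof.
move=> cf A [P fP PA].
have : \forall s \near t, forall j, P 0 j (f s 0 j).
  by apply: filter_forall => j; apply: cf; exact: fP.
by apply: filterS => s Ps; apply: PA => i j; rewrite ord1; exact: Ps.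
Qed.

Lemma stereo_dom_open q b : open (@stereo_dom q b).
Proof.
apply: (@open_comp _ _ (fun x : sphere q => (val x : 'rV[R]_q.+1) 0 0)
  [set a | a != (-1) ^+ b]); first by move=> x _; exact: sphere_coord_cont.
exact: open_neq.
Qed.

Lemma stereo_range_open q b : open (@stereo q b @` @stereo_dom q b).
Proof. by rewrite stereo_range; exact: openT. Qed.

Lemma stereo_cont q b (x : sphere q) :
  stereo_dom b x -> {for x, continuous (@stereo q b)}.
Proof.
move=> /stereo_dom_denom xb; apply: cvg_rV => j.
have -> : (fun x : sphere q => stereo b x 0 j) =
    (fun x : sphere q => (1 - (-1) ^+ b * (val x : 'rV[R]_q.+1) 0 0)^-1 *
                (val x : 'rV[R]_q.+1) 0 (rshift 1 j)).
  by apply/funext => z; rewrite !mxE.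
apply: continuousM; last exact: sphere_coord_cont.
apply: continuousV => //; apply: continuousB; first exact: cst_continuous.
by apply: continuousM; [exact: cst_continuous|exact: sphere_coord_cont].
Qed.

Lemma Ck_dotr k q (U : set 'rV[R]_q) : open U -> Ck k U (fun u => dotr u u).
Proof.
by move=> oU; apply: Ck_sum => // j; apply: CkM => //; exact: Ck_coord.
Qed.

Lemma stereo_inv_smooth q b : smooth_on setT (@stereo_inv_fun q b).
Proof.
move=> k j; have oT := @openT 'rV[R]_q.
have d0 (u : 'rV[R]_q) : setT u -> dotr u u + 1 != 0.
  by move=> _; apply: lt0r_neq0; have := dotr_ge0 u; lra.
have kV : Ck k setT (fun u : 'rV[R]_q => (dotr u u + 1)^-1).
  apply: CkV => //; apply: CkD => //; first exact: Ck_dotr.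
  exact: Ck_cst.
case: (unliftP ord0 j) => [i|] ->; last first.
  pose f (u : 'rV[R]_q) := (-1) ^+ b * ((dotr u u + -1) * (dotr u u + 1)^-1).
  apply: (@eq_Ck _ _ _ _ f) => // [u _|].
    by rewrite /stereo_inv_fun row_mx_head.
  apply: CkM => //; first exact: Ck_cst.
  apply: CkM => //; apply: CkD => //; first exact: Ck_dotr.
  exact: Ck_cst.
pose f (u : 'rV[R]_q) := (2 * (dotr u u + 1)^-1) * u 0 i.
apply: (@eq_Ck _ _ _ _ f) => // [u _|].
  by rewrite /stereo_inv_fun row_mx_tail mxE.
apply: CkM => //; last exact: Ck_coord.
apply: CkM => //; exact: Ck_cst.
Qed.

Lemma stereo_inv_cont q b : continuous (@stereo_inv q b).
Proof.
apply: continuous_comp_initial => u; apply: cvg_rV => j.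
exact: (Ck_cont (stereo_inv_smooth b 0 j)).
Qed.

Definition stereo_chart q (b : bool) : chart q (sphere q) :=
  Chart (@stereo_dom_open q b) (@stereo_range_open q b) (@stereoK q b)
    (@stereo_cont q b) (fun u _ => @stereo_inv_cont q b u).

Lemma stereo_cover q (x : sphere q) :
  exists2 c, range (@stereo_chart q) c & chart_dom c x.
Proof.
have [x0|x0] := eqVneq ((val x : 'rV[R]_q.+1) 0 0) 1.
  exists (stereo_chart q true); first by exists true.
  rewrite /= /stereo_dom /= x0 expr1 -subr_eq0 opprK.
  by apply: lt0r_neq0; lra.
by exists (stereo_chart q false); [exists false|rewrite /= /stereo_dom /= expr0].
Qed.

Lemma stereo_compat q c d : range (@stereo_chart q) c ->
  range (@stereo_chart q) d ->
  smooth_on (c @` (chart_dom c `&` chart_dom d)) (d \o chart_inv c).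
Proof.
move=> [b _ <-] [b' _ <-] /=; set U := (X in smooth_on X).
have UE : U = stereo_inv b @^-1` stereo_dom b'.
  apply/seteqP; split => [u [x [xb xb'] <-] /=|u /= ub'].
    by rewrite stereoK.
  exists (stereo_inv b u); last exact: stereo_invK.
  by split => //; exact: stereo_inv_dom.
have oU : open U.
  rewrite UE; apply: open_comp; last exact: stereo_dom_open.
  by move=> u _; exact: stereo_inv_cont.
have kI k j : Ck k U (fun u => stereo_inv_fun b u 0 j).
  by apply: CkT; exact: stereo_inv_smooth.
move=> k j.
pose f (u : 'rV[R]_q) := (1 + - (-1) ^+ b' * stereo_inv_fun b u 0 0)^-1 *
                (stereo_inv_fun b u 0 (rshift 1 j)).
apply: (@eq_Ck _ _ _ _ f) => // [u _|].
  by rewrite /f /= /stereo [RHS]mxE mulNr; congr (_ * _); rewrite [RHS]mxE.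
apply: CkM => //; apply: CkV => // [u|].
  by rewrite UE => /stereo_dom_denom /=; rewrite mulNr.
apply: CkD => //; first exact: Ck_cst.
by apply: CkM => //; exact: Ck_cst.
Qed.

Definition sphere_atlas q : atlas q (sphere q) :=
  Atlas (@stereo_cover q) (@stereo_compat q).

End sphere.

Arguments sphere : clear implicits.

Section sphere_metric.
Context {R : realType} {q : nat}.
Implicit Types (x y p : sphere R q) (T : set (sphere R q)).

(* Length of the shorter great-circle arc between x and y. *)
Definition sdist x y : R := acos (dotr (val x) (val y)).

Definition sdist_set x T : R := inf [set sdist x y | y in T].

Definition geodesic_ball p (r : R) : set (sphere R q) :=
  [set x | sdist x p <= r].

Definition equator p : set (sphere R q) :=
  [set x | dotr (val x) (val p) = 0].

Definition strip p (L : R) : set (sphere R q) :=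
  [set x | sdist_set x (equator p) <= L].

(* Right multiplication by this matrix sends w to w - <w, x> x, the orthogonal
   projection of w onto the tangent space of the sphere at x. *)
Definition tangent_proj x : 'M[R]_q.+1 := 1%:M - (val x)^T *m val x.

End sphere_metric.

Section hypersurfaces.
Context {R : realType} {n : nat} {M : topologicalType}.
Variable A : @atlas R n M.
Implicit Types (c : @chart R n M) (x eta : M -> sphere R n.+1) (p : M).

(* The i-th row is the derivative of f along the i-th coordinate vector field
   of the chart c. *)
Definition chart_jacobian q c (f : M -> 'rV[R]_q) p : 'M[R]_(n, q) :=
  jacobian (f \o chart_inv c) (c p).

Definition immersion x : Prop :=
  smooth_map A (@sphere_atlas R n.+1) x /\
  forall c p, charts A c -> chart_dom c p ->
    row_free (chart_jacobian c (val \o x) p).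

(* An orientation of an immersed hypersurface of the (oriented) sphere is the
   same thing as a globally defined smooth unit normal field. *)
Definition unit_normal x eta : Prop :=
  [/\ smooth_map A (@sphere_atlas R n.+1) eta,
      forall p, dotr (val (eta p)) (val (x p)) = 0
    & forall c p, charts A c -> chart_dom c p -> forall i : 'I_n,
        dotr (row i (chart_jacobian c (val \o x) p)) (val (eta p)) = 0].

(* The i-th row is the covariant derivative of the vector field eta along x in
   the i-th coordinate direction: the Riemannian connection of the sphere is
   the tangential part of the Euclidean derivative. *)
Definition covariant_derivative c x eta p : 'M[R]_(n, n.+2) :=
  chart_jacobian c (val \o eta) p *m tangent_proj (x p).

(* Matrix of v |-> - nabla_v eta in the basis of the coordinate vectors
   d_0, ..., d_(n-1) of the chart c, acting on row vectors: the image of d_i is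
   \sum_j (shape_operator c x eta p) i j *: d_j. *)
Definition shape_operator c x eta p : 'M[R]_n :=
  - covariant_derivative c x eta p *m pinvmx (chart_jacobian c (val \o x) p).

(* l lists, in any order, the eigenvalues of the shape operator at p with their
   multiplicities; this does not depend on the chart. *)
Definition principal_curvatures x eta p (l : 'I_n -> R) : Prop :=
  forall c, charts A c -> chart_dom c p ->
    char_poly (shape_operator c x eta p) = \prod_(i < n) ('X - (l i)%:P).

End hypersurfaces.

Arguments atlas : clear implicits.
Arguments sphere_atlas : clear implicits.

(* Main.v *)
Require Import Defs.
From HB Require Import structures.
From mathcomp Require Import all_boot all_order all_algebra.
From mathcomp Require Import all_classical all_reals all_analysis.
From mathcomp Require Import ring lra.

Set Implicit Arguments.
Unset Strict Implicit.
Unset Printing Implicit Defensive.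

Import Order.TTheory GRing.Theory Num.Theory.
Import numFieldNormedType.Exports.

Local Open Scope classical_set_scope.
Local Open Scope ring_scope.

(** The hypersurface avoids the antipode of [p0], so stereographic projection
    from [- p0] turns it into a hypersurface of a Euclidean space. This is a
    conformal change of metric, and it shifts every principal curvature by
    [mu = <eta, p0> / (1 + <x, p0>)], up to a positive factor. The strip and
    the ball give [|mu| <= sin L / (1 + cos r)], so the hypothesis on the
    curvatures prevents the shifted curvatures from vanishing: the Euclidean
    Gauss map has an invertible differential everywhere. It is then a local
    diffeomorphism from a compact connected manifold to a sphere of dimension
    at least 2, which is simply connected, hence it is a diffeomorphism.

    Geometry. The Euclidean Gauss map is [N = eta - mu (x + p0)], which is the
    image of [eta] under the reflection exchanging [x] and [- p0]; it is a unit
    vector orthogonal to [p0]. No projection has to be differentiated: from the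
    Weingarten equation [d eta = - A dx] one gets
    [dN = - dx (A + mu) - dmu (x + p0)], and a vector [w] killed by [dN] is
    killed by [dmu] (take the inner product with [x]) and then by [A + mu];
    see [gauss_derivative_injective]. An orthonormal basis of the complement of
    [p0] ([orthonormal_complement]) makes [N] a map to the standard sphere.

    Topology. That a local homeomorphism to the sphere is injective is proved
    without covering theory, by a mountain pass argument on the height of the
    image point. Its strict maxima are the points over the north pole, and
    every lower level is crossed without a change of topology: near a point at
    level [t] the part strictly above [t] is connected, as the intersection of
    two convex sets or, over the south pole, as a punctured ball, which is
    where dimension at least 2 is used. Two distinct summits could be separated just
    below the top, hence at all lower levels, which contradicts connectedness
    ([unique_summit]). So the fibre over the north pole has at most one point,
    and the set of points with several preimages, which is open and closed in
    the sphere, is empty ([sphere_cover_injective]).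

    Analysis. Smoothness is given by iterated partial derivatives. The mean
    value theorem along coordinate segments gives strict differentiability
    ([strict_diff]), and the contraction principle then gives the inverse
    function theorem ([local_surj], [inverse_smooth]), by which the inverse of
    a smooth bijection with invertible Jacobians is smooth. *)

(** * Differential calculus on row vectors *)

Section row_vectors.
Context {R : realType}.

Lemma rV_le_norm m (u : 'rV[R]_m) i : `|u 0 i| <= `|u|.
Proof.
rewrite [leRHS]/Num.Def.normr/= mx_normrE.
exact: (le_bigmax _ (fun ij : 'I_1 * 'I_m => `|u ij.1 ij.2|) (0, i)).
Qed.

Lemma rV_norm_le m (u : 'rV[R]_m) (b : R) : 0 <= b ->
  (forall i, `|u 0 i| <= b) -> `|u| <= b.
Proof.
move=> b0 ub; rewrite [leLHS]/Num.Def.normr/= mx_normrE.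
by apply: bigmax_le => // -[i j] _ /=; rewrite ord1.
Qed.

Lemma mulmxr_continuous m q (B : 'M[R]_(m, q)) :
  continuous (mulmxr B : 'rV[R]_m -> 'rV[R]_q).
Proof.
move=> u; apply: (@cvg_rV R) => j.
have -> : (fun s : 'rV[R]_m => mulmxr B s 0 j) =
          (fun s => \sum_k s 0 k * B k j).
  by apply/funext => s; rewrite /= mxE.
suff : Ck 0 setT (fun s : 'rV[R]_m => \sum_k s 0 k * B k j) by case=> + _; apply.
apply: Ck_sum => [|k]; first exact: openT.
by apply: CkM; [exact: openT|exact: Ck_coord|exact: Ck_cst].
Qed.

Lemma mulmxr_bound m q (B : 'M[R]_(m, q)) :
  exists2 K : R, 0 < K & forall u : 'rV[R]_m, `|u *m B| <= K * `|u|.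
Proof. by have [K K0 KB] := linear_lipschitz (@mulmxr_continuous m q B); exists K. Qed.

End row_vectors.

Section partial_derivatives.
Context {R : realType}.

Lemma is_derive_line m (f : 'rV[R]_m -> R) (u v : 'rV[R]_m) (c : R) :
  derivable f (u + c *: v) v ->
  is_derive c 1 (fun t : R => f (u + t *: v)) ('D_v f (u + c *: v)).
Proof.
have E :
  (fun h : R => h^-1 *: ((f \o shift (u + c *: v)) (h *: v) - f (u + c *: v))) =
  (fun h : R => h^-1 *: (((fun t => f (u + t *: v)) \o shift c) (h *: 1) -
     f (u + c *: v))).
  apply/funext => h; congr (_ *: (f _ - _)).
  by rewrite /= scalerDl [h *: 1]mulr1 addrCA addrA.
by move=> d; apply: DeriveDef; rewrite /derivable /derive -?E.
Qed.

(** The mean value theorem along one direction, as an inequality in which [h]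
    may have either sign. *)
Lemma coord_increment m (f : 'rV[R]_m -> R) (u v : 'rV[R]_m) (h a e : R) :
  (forall c, `|c| <= `|h| -> derivable f (u + c *: v) v /\
     `|'D_v f (u + c *: v) - a| <= e) ->
  `|f (u + h *: v) - f u - h * a| <= e * `|h|.
Proof.
move=> fd; pose phi (t : R) : R := f (u + t *: v).
pose dphi (t : R) : R := 'D_v f (u + t *: v).
have D (c : R) : `|c| <= `|h| -> is_derive c 1 phi (dphi c).
  by move=> /fd [d _]; exact: is_derive_line.
have C (c : R) : `|c| <= `|h| -> {for c, continuous phi}.
  by move=> /D dc; apply/differentiable_continuous/derivable1_diffP.
suff [c ch E] : exists2 c, `|c| <= `|h| & phi h - phi 0 = dphi c * h.
  have -> : f u = phi 0 by rewrite /phi scale0r addr0.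
  rewrite -[f _]/(phi h) E mulrC -mulrBr normrM mulrC ler_wpM2r//.
  by have [] := fd c ch.
have [h0|h0] := leP 0 h.
  have W c : c \in `[0, h]%R -> `|c| <= `|h|.
    by rewrite in_itv /= => /andP[c0 ch]; rewrite !ger0_norm.
  have [||c cI E] := @MVT_segment _ phi dphi 0 h h0.
  - by move=> c /subset_itv_oo_cc /W /D.
  - by apply: continuous_in_subspaceT => c /set_mem /= /W /C.
  by exists c; [exact: W|rewrite E subr0].
have W c : c \in `[h, 0]%R -> `|c| <= `|h|.
  rewrite in_itv /= => /andP[hc c0]; rewrite !ler0_norm ?(ltW h0)//.
  by rewrite lerN2.
have [||c cI E] := @MVT_segment _ phi dphi h 0 (ltW h0).
- by move=> c /subset_itv_oo_cc /W /D.
- by apply: continuous_in_subspaceT => c /set_mem /= /W /C.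
exists c; first exact: W.
by apply/eqP; rewrite -eqr_opp opprB E sub0r mulrN.
Qed.

(** Matrix of partial derivatives. It makes sense without differentiability, as
    [Ck] only speaks of partial derivatives, and it agrees with [jacobian] at
    the points of differentiability ([jacobianE]). *)
Definition pjacobian m q (f : 'rV[R]_m -> 'rV[R]_q) (u : 'rV[R]_m) : 'M[R]_(m, q) :=
  \matrix_(i, j) 'D_(delta_mx 0 i) (fun v => f v 0 j) u.

(** One goes from [u] to [v] by changing the coordinates one at a time. All the
    intermediate points stay near [u0], where the partial derivatives are close
    to their values at [u0], and each step is controlled by
    [coord_increment]. *)
Lemma strict_diff_coord m (U : set 'rV[R]_m) (f : 'rV[R]_m -> R) u0 (e : R) :
  open U -> Ck 1 U f -> U u0 -> 0 < e ->
  exists2 d, 0 < d & forall u v, `|u - u0| < d -> `|v - u0| < d ->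
   `|f v - f u - \sum_i (v - u) 0 i * 'D_(delta_mx 0 i) f u0| <= e * `|v - u|.
Proof.
move=> oU [_ kf] Uu0 e0; pose D i := 'D_(delta_mx 0 i : 'rV[R]_m) f.
pose e' := e / m.+1%:R; have e'0 : 0 < e' by rewrite divr_gt0.
pose P (i : 'I_m) (u : 'rV[R]_m) : Prop :=
  derivable f u (delta_mx 0 i) /\ `|D i u - D i u0| <= e'.
have : \forall u \near u0, forall i, P i u.
  apply: (@filter_forall _ _ P (nbhs u0) _) => i; have [d1 [d2 _]] := kf i.
  near=> u; split.
    by apply: d1; near: u; exact: open_nbhs_nbhs.
  rewrite distrC; near: u.
  by move/cvgrPdist_le : (d2 u0 Uu0); apply.
move=> /nbhs_normP[d /= d0 dP]; exists (d / 3); first by rewrite divr_gt0.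
move=> u v uu0 vu0.
(* [w k] has the first [k] coordinates of [v] and the other ones of [u]. *)
pose w k : 'rV[R]_m := \row_j if (j < k)%N then v 0 j else u 0 j.
have w0 : w 0%N = u by apply/rowP => j; rewrite mxE.
have wm : w m = v by apply/rowP => j; rewrite mxE ltn_ord.
have wS (i : 'I_m) : w i.+1 = w i + ((v - u) 0 i) *: delta_mx 0 i.
  apply/rowP => j; rewrite !mxE eqxx /= ltnS leq_eqVlt.
  have [->|ji] := eqVneq j i; first by rewrite eqxx ltnn /= mulr1 addrC subrK.
  by rewrite (negbTE (_ : val j != val i))//= mulr0 addr0.
have w_near k : `|w k - u0| <= Num.max `|u - u0| `|v - u0|.
  apply: rV_norm_le => [|j]; first by rewrite le_max normr_ge0.
  have := rV_le_norm (u - u0) j; have := rV_le_norm (v - u0) j.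
  rewrite !mxE le_max; case: ifP => _ av au; first by rewrite av orbT.
  by rewrite au.
have step (i : 'I_m) :
    `|f (w i.+1) - f (w i) - (v - u) 0 i * D i u0| <= e' * `|v - u|.
  rewrite wS; apply: le_trans (_ : e' * `|(v - u) 0 i| <= _); last first.
    by rewrite ler_wpM2l ?rV_le_norm// ltW.
  apply: coord_increment => c ch; apply: dP => /=.
  rewrite distrC addrAC; apply: le_lt_trans (ler_normD _ _) _.
  rewrite normrZ (_ : d = d / 3 + (d / 3 + d / 3)); last by field.
  rewrite ltr_leD//.
    by apply: le_lt_trans (w_near i) _; rewrite gt_max uu0 vu0.
  apply: le_trans (_ : `|v - u| * 1 <= _).
    apply: ler_pM => //; first by apply: le_trans ch _; exact: rV_le_norm.
    apply: rV_norm_le => // j; rewrite mxE eqxx /=.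
    by case: (j == i); rewrite ?normr1 ?normr0.
  rewrite mulr1 (_ : v - u = (v - u0) - (u - u0)); last by rewrite opprB addrA subrK.
  by apply: le_trans (ler_normB _ _) _; rewrite lerD// ltW.
have -> : f v - f u = \sum_(i < m) (f (w i.+1) - f (w i)).
  by rewrite -(big_mkord xpredT (fun i => f (w i.+1) - f (w i))) telescope_sumr// wm w0.
rewrite -sumrB; apply: le_trans (ler_norm_sum _ _ _) _.
apply: le_trans (ler_sum _ (fun i _ => step i)) _.
rewrite sumr_const card_ord -mulr_natl mulrA ler_wpM2r// /e' mulrCA ler_piMr ?(ltW e0)//.
by rewrite ler_pdivrMr// mul1r ler_nat.
Unshelve. all: by end_near. Qed.

(** The estimate holds for pairs of points near [u0], not only for pairs
    containing [u0]; this is what makes the map minus its linear part a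
    contraction in the inverse function theorem. *)
Lemma strict_diff m q (U : set 'rV[R]_m) (f : 'rV[R]_m -> 'rV[R]_q) u0 (e : R) :
  open U -> (forall j, Ck 1 U (fun u => f u 0 j)) -> U u0 -> 0 < e ->
  exists2 d, 0 < d & forall u v, `|u - u0| < d -> `|v - u0| < d ->
   `|f v - f u - (v - u) *m pjacobian f u0| <= e * `|v - u|.
Proof.
move=> oU kf Uu0 e0.
have : \forall d \near 0^'+, forall j u v, `|u - u0| < d -> `|v - u0| < d ->
   `|(f v - f u - (v - u) *m pjacobian f u0) 0 j| <= e * `|v - u|.
  apply: filter_forall => j.
  have [d d0 dP] := strict_diff_coord oU (kf j) Uu0 e0.
  near=> d' => u v uu0 vu0.
  have -> : (f v - f u - (v - u) *m pjacobian f u0) 0 j =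
    f v 0 j - f u 0 j -
    \sum_i (v - u) 0 i * 'D_(delta_mx 0 i) (fun u => f u 0 j) u0.
    by rewrite !mxE; congr (_ - _); apply: eq_bigr => i _; rewrite !mxE.
  have dd : d' < d by near: d'; exact: nbhs_right_lt.
  by apply: dP; [exact: lt_trans dd|exact: lt_trans dd].
move=> H; have : \forall d \near (0:R)^'+, (0 < d)%R by exact: nbhs_right_gt.
move=> /(filterI H)/filter_ex[d [dP d0]]; exists d => // u v uu0 vu0.
apply: rV_norm_le => [|j]; first by rewrite mulr_ge0// ltW.
exact: dP.
Unshelve. all: by end_near. Qed.

Lemma is_diff_of_approx (V W : normedModType R) (f : V -> W)
    (df : {linear V -> W}) (x : V) : continuous df ->
  (forall e : R, 0 < e -> \forall u \near x,
     `|f u - f x - df (u - x)| <= e * `|u - x|) ->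
  is_diff x f df.
Proof.
move=> cB fB.
have E : f \o shift x = cst (f x) + df +o_ 0 id.
  apply/eqaddoP => _/posnumP[e].
  have := fB _ (gt0 e); rewrite (near_shift 0) subr0 => fBe.
  near=> u; have : `|f (u + x) - f x - df (u + x - x)| <= e%:num * `|u + x - x|.
    by near: u; exact: fBe.
  by rewrite /= addrK !fctE opprD addrA.
have dE : 'd f x = df :> (V -> W) by exact: diff_unique.
by split => //; apply/diff_locallyP; rewrite dE.
Unshelve. all: by end_near. Qed.

Lemma diff_of_approx m q (f : 'rV[R]_m -> 'rV[R]_q) (u0 : 'rV[R]_m)
    (B : 'M[R]_(m, q)) :
  (forall e : R, 0 < e -> \forall u \near u0,
     `|f u - f u0 - (u - u0) *m B| <= e * `|u - u0|) ->
  is_diff u0 f (mulmxr B).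
Proof.
exact: (@is_diff_of_approx 'rV[R]_m 'rV[R]_q f (mulmxr B) u0
  (@mulmxr_continuous R m q B)).
Qed.

Lemma C1_is_diff m q (U : set 'rV[R]_m) (f : 'rV[R]_m -> 'rV[R]_q) u0 :
  open U -> (forall j, Ck 1 U (fun u => f u 0 j)) -> U u0 ->
  is_diff u0 f (mulmxr (pjacobian f u0)).
Proof.
move=> oU kf Uu0; apply: diff_of_approx => e e0.
have [d d0 dP] := strict_diff oU kf Uu0 e0.
apply/nbhs_normP; exists d => // u /= uu0.
by apply: dP; rewrite ?subrr ?normr0 1?distrC.
Qed.

Lemma derive_coord m q (f : 'rV[R]_m -> 'rV[R]_q) (u v : 'rV[R]_m) (j : 'I_q) :
  differentiable f u ->
  derivable (fun w => f w 0 j) u v /\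
  'D_v (fun w => f w 0 j) u = ('d f u : 'rV[R]_m -> 'rV[R]_q) v 0 j.
Proof.
move=> df; have dv : derivable f u v by exact: diff_derivable.
split.
  by move/derivable_mxP : dv; apply.
by rewrite -deriveE// derive_mx// mxE.
Qed.

Lemma jacobianE m q (f : 'rV[R]_m -> 'rV[R]_q) (u : 'rV[R]_m) : differentiable f u ->
  jacobian f u = pjacobian f u.
Proof.
move=> df; apply/matrixP => i j; rewrite !mxE.
by have [_ ->] := derive_coord (delta_mx 0 i) j df.
Qed.

Lemma is_diff_pjacobian m q (f : 'rV[R]_m -> 'rV[R]_q) (u : 'rV[R]_m)
    (B : 'M[R]_(m, q)) :
  is_diff u f (mulmxr B) -> pjacobian f u = B.
Proof.
move=> df; apply/matrixP => i j; rewrite !mxE.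
have [_ ->] := derive_coord (delta_mx 0 i) j ex_diff.
by rewrite diff_val /= -rowE mxE.
Qed.

Lemma pjacobian_comp m q s (U : set 'rV[R]_m) (V : set 'rV[R]_q)
    (f : 'rV[R]_m -> 'rV[R]_q) (g : 'rV[R]_q -> 'rV[R]_s) u :
  open U -> open V -> (forall j, Ck 1 U (fun u => f u 0 j)) ->
  (forall j, Ck 1 V (fun v => g v 0 j)) -> U u -> V (f u) ->
  is_diff u (g \o f) (mulmxr (pjacobian f u *m pjacobian g (f u))).
Proof.
move=> oU oV kf kg Uu Vfu.
have df := C1_is_diff oU kf Uu; have dg := C1_is_diff oV kg Vfu.
split; first by apply: differentiable_comp.
rewrite diff_comp// !diff_val; apply/funext => w /=.
by rewrite mulmxA.
Qed.

Lemma Ck_le k l m (U : set 'rV[R]_m) f : (l <= k)%N -> Ck k U f -> Ck l U f.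
Proof.
move=> /subnK <-; elim: (k - l)%N => // i IH; rewrite addSn => /CkS; exact: IH.
Qed.

(** By induction on [k]: the chain rule writes a partial derivative of the
    composite with products of [C^k] functions and with partial derivatives of
    [g] composed with [f], to which the induction hypothesis applies. *)
Lemma Ck_comp k m q (U : set 'rV[R]_m) (V : set 'rV[R]_q)
    (f : 'rV[R]_m -> 'rV[R]_q) (g : 'rV[R]_q -> R) :
  open U -> open V -> (forall j, Ck k U (fun u => f u 0 j)) -> Ck k V g ->
  (forall u, U u -> V (f u)) -> Ck k U (g \o f).
Proof.
move=> oU oV; elim: k g => [|k IH] g kf kg UV.
  split => // u Uu; apply: continuous_comp; last exact: (Ck_cont kg (UV u Uu)).
  by apply: cvg_rV => j; exact: (Ck_cont (kf j)).
pose g' v : 'rV[R]_1 := \row_i g v.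
have kg' j : Ck k.+1 V (fun v => g' v 0 j).
  by rewrite (_ : (fun v => _) = g)//; apply/funext => v; rewrite mxE.
have D u : U u -> is_diff u (g' \o f) (mulmxr (pjacobian f u *m pjacobian g' (f u))).
  move=> Uu; apply: (pjacobian_comp oU oV _ _ Uu (UV u Uu)) => j.
    by apply: (@Ck_le k.+1); [|exact: kf].
  by apply: (@Ck_le k.+1); [|exact: kg'].
have gE : g \o f = fun u => (g' \o f) u 0 0 by apply/funext => u; rewrite /= mxE.
split.
  move=> u Uu; apply: continuous_comp; last exact: (Ck_cont kg (UV u Uu)).
  by apply: cvg_rV => j; exact: (Ck_cont (kf j)).
move=> i; split => [u Uu|].
  rewrite gE; have [dd _] := D u Uu.
  by have [] := derive_coord (delta_mx 0 i) 0 dd.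
apply: (@eq_Ck _ _ _ _ (fun u => \sum_j 'D_(delta_mx 0 i) (fun u => f u 0 j) u *
   ('D_(delta_mx 0 j) g \o f) u)) => // [u Uu|].
  have /matrixP/(_ i 0) := is_diff_pjacobian (D u Uu).
  rewrite !mxE -gE => ->; apply: eq_bigr => j _; rewrite !mxE; congr (_ * _).
  by congr ('D_ _ _ _); apply/funext => v; rewrite mxE.
apply: Ck_sum => [|j]; first exact: oU.
apply: CkM; first exact: oU.
  by have [_ kfj] := kf j; have [] := kfj i.
apply: IH => //; first by move=> j'; exact: CkS.
by have [_ kgj] := kg; have [] := kgj j.
Qed.

Lemma Ck_local k m (U : set 'rV[R]_m) (f : 'rV[R]_m -> R) :
  (forall u, U u -> exists2 V, V u & Ck k V f) -> Ck k U f.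
Proof.
elim: k f => [|k IH] f Uf.
  by split => // u /Uf[V Vu [cf _]]; exact: cf.
split=> [u /Uf[V Vu [cf _]]|i]; first exact: cf.
split=> [u /Uf[V Vu [_ df]]|]; first by have [d1 _] := df i; exact: d1.
by apply: IH => u /Uf[V Vu [_ df]]; exists V => //; have [_] := df i.
Qed.

Lemma smooth_on_sub m q (U V : set 'rV[R]_m) (f : 'rV[R]_m -> 'rV[R]_q) :
  U `<=` V -> smooth_on V f -> smooth_on U f.
Proof. by move=> UV sf k j; apply: Ck_local => u /UV Vu; exists V. Qed.

Lemma smooth_on_mulmxr m q s (U : set 'rV[R]_m) (f : 'rV[R]_m -> 'rV[R]_q)
    (B : 'M[R]_(q, s)) : open U -> smooth_on U f ->
  smooth_on U (fun u => f u *m B).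
Proof.
move=> oU sf k j.
apply: (eq_Ck oU (f := fun u => \sum_i f u 0 i * B i j)) => [u _|].
  by rewrite mxE.
apply: Ck_sum => [|i]; first exact: oU.
by apply: CkM; [exact: oU|exact: sf|exact: Ck_cst].
Qed.

Lemma eq_pjacobian m q (U : set 'rV[R]_m) (f g : 'rV[R]_m -> 'rV[R]_q) u :
  open U -> U u -> (forall v, U v -> f v = g v) -> pjacobian f u = pjacobian g u.
Proof.
move=> oU Uu fg; apply/matrixP => i j; rewrite !mxE.
apply: near_eq_derive; apply: filterS (open_nbhs_nbhs (conj oU Uu)) => v /fg.
by move=> ->.
Qed.

Lemma pjacobian_mulmxr m q s (U : set 'rV[R]_m) (f : 'rV[R]_m -> 'rV[R]_q)
    (B : 'M[R]_(q, s)) u : open U -> smooth_on U f -> U u ->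
  pjacobian (fun v => f v *m B) u = pjacobian f u *m B.
Proof.
move=> oU sf Uu; have df := C1_is_diff oU (sf 1%N) Uu.
apply: is_diff_pjacobian.
have dB : differentiable (mulmxr B : 'rV[R]_q -> 'rV[R]_s) (f u).
  by apply: linear_differentiable; exact: mulmxr_continuous.
split; first exact: (@differentiable_comp _ _ _ _ f (mulmxr B)).
rewrite -[X in 'd X _]/((mulmxr B : 'rV[R]_q -> 'rV[R]_s) \o f) diff_comp//.
rewrite diff_val diff_lin; last exact: mulmxr_continuous.
by apply/funext => w /=; rewrite mulmxA.
Qed.

End partial_derivatives.

(** * The inverse function theorem *)

HB.instance Definition _ (R : realType) (m n : nat) := Complete.on 'M[R]_(m, n).

Section inverse_function.
Context {R : realType}.

(** Newton's map with frozen derivative, [u |-> u - (F u - y) J^-1], is a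
    contraction of ratio 1/2 near [u0] by [strict_diff], and it preserves a
    small closed ball around [u0] as soon as [y] is close to [F u0]. Its fixed
    point is a solution of [F u = y]. *)
Lemma local_surj m (V : set 'rV[R]_m) (F : 'rV[R]_m -> 'rV[R]_m) (u0 : 'rV[R]_m)
    (W : set 'rV[R]_m) :
  open V -> (forall j, Ck 1 V (fun u => F u 0 j)) -> V u0 ->
  pjacobian F u0 \in unitmx -> nbhs u0 W -> nbhs (F u0) (F @` W).
Proof.
move=> oV kF Vu0 Ju W_u0; set J := pjacobian F u0 in Ju *.
have [K K0 KB] := mulmxr_bound (invmx J).
have e0 : 0 < (2 * K)^-1 by rewrite invr_gt0 mulr_gt0.
have [d d0 dP] := strict_diff oV kF Vu0 e0.
have /nbhs_normP[d' /= d'0 d'W] := W_u0.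
pose rho := Num.min d d' / 2.
have rho0 : 0 < rho by rewrite divr_gt0// lt_min d0 d'0.
have rho_lt : rho < Num.min d d'.
  by rewrite /rho ltr_pdivrMr// ltr_pMr ?ltr1n// lt_min d0 d'0.
have /andP[rhod rhod'] : (rho < d) && (rho < d') by rewrite -lt_min.
pose U := [set u : 'rV[R]_m | `|u0 - u| <= rho].
have UE : U = closed_ball u0 rho by rewrite closed_ballE.
have cU : closed U by rewrite UE; exact: closed_ball_closed.
have U0 : U !=set0 by exists u0; rewrite /U /= subrr normr0 ltW.
have Ud u : U u -> `|u - u0| < d by move=> ?; rewrite distrC; apply: le_lt_trans rhod.
suff S y : `|y - F u0| < rho / (2 * K) -> exists2 u, U u & F u = y.
  apply/(@nbhs_normP R 'rV[R]_m); exists (rho / (2 * K)) => /=.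
    by rewrite divr_gt0// mulr_gt0.
  move=> y /=; rewrite distrC => /S[u Uu <-]; exists u => //.
  by apply: d'W => /=; exact: le_lt_trans rhod'.
move=> yF; pose Phi (u : 'rV[R]_m) : 'rV[R]_m := u - (F u - y) *m invmx J.
have PhiB u v : Phi v - Phi u = - ((F v - F u - (v - u) *m J) *m invmx J).
  rewrite /Phi !mulmxBl !mulmxK//.
  move: (F v *m _) (F u *m _) (y *m _) => P Q Y.
  by apply/rowP => j; rewrite !mxE; ring.
have contr u v : U u -> U v -> `|Phi v - Phi u| <= 2^-1 * `|v - u|.
  move=> Uu Uv; rewrite PhiB normrN; apply: le_trans (KB _) _.
  rewrite (_ : 2^-1 = K * (2 * K)^-1); last by field; rewrite gt_eqF.
  by rewrite -mulrA ler_pM2l//; apply: dP; exact: Ud.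
have PhiU u : U u -> U (Phi u).
  move=> Uu; rewrite /U /=.
  rewrite (_ : u0 - Phi u = (u0 - Phi u0) + (Phi u0 - Phi u)); last first.
    by rewrite addrA subrK.
  apply: le_trans (ler_normD _ _) _; rewrite [leRHS]splitr lerD//.
    rewrite /Phi opprB addrCA subrr addr0; apply: le_trans (KB _) _.
    rewrite (_ : rho / 2 = K * (rho / (2 * K))); last by field; rewrite gt_eqF.
    by rewrite ler_pM2l// distrC ltW.
  have Uu0 : U u0 by rewrite /U /= subrr normr0 ltW.
  apply: le_trans (contr u u0 Uu Uu0) _.
  by rewrite mulrC ler_pM2r ?invr_gt0.
pose PhiF : {fun U >-> U} := HB.pack Phi (isFun.Build _ _ _ _ Phi PhiU).
have cPhi : is_contraction PhiF.
  exists (2^-1)%:nng; split; first by rewrite /= invf_lt1 ?ltr1n.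
  by move=> -[u v] /= [Uu Uv]; exact: contr.
have [u Uu uE] := @banach_fixed_point R 'rV[R]_m U PhiF cPhi cU U0.
exists u => //; have /(congr1 (mulmxr J)) : (F u - y) *m invmx J = 0.
  have : u = Phi u by [].
  by rewrite /Phi => /eqP; rewrite -subr_eq0 opprB addrCA subrr addr0 => /eqP.
by rewrite /= mulmxKV// mul0mx => /eqP; rewrite subr_eq0 => /eqP.
Qed.

Lemma local_inj m (V : set 'rV[R]_m) (F : 'rV[R]_m -> 'rV[R]_m) (u0 : 'rV[R]_m) :
  open V -> (forall j, Ck 1 V (fun u => F u 0 j)) -> V u0 ->
  pjacobian F u0 \in unitmx ->
  exists2 W, nbhs u0 W & forall u v, W u -> W v -> F u = F v -> u = v.
Proof.
move=> oV kF Vu0 Ju; set J := pjacobian F u0 in Ju.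
have [K K0 KB] := mulmxr_bound (invmx J).
have e0 : 0 < (2 * K)^-1 by rewrite invr_gt0 mulr_gt0.
have [d d0 dP] := strict_diff oV kF Vu0 e0; rewrite -/J in dP.
exists [set u | `|u - u0| < d].
  by apply/(@nbhs_normP R 'rV[R]_m); exists d => // u /=; rewrite distrC.
move=> u v ud vd Fuv; have := dP u v ud vd.
rewrite Fuv subrr sub0r normrN => H.
have : `|v - u| <= 2^-1 * `|v - u|.
  rewrite -[in leLHS](mulmxK Ju (v - u)); apply: le_trans (KB _) _.
  rewrite (_ : 2^-1 = K * (2 * K)^-1); last by field; rewrite gt_eqF.
  by rewrite -mulrA ler_pM2l.
move=> H2; apply/esym/eqP; rewrite -subr_eq0 -normr_le0.
by have := normr_ge0 (v - u); lra.
Qed.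

(** Put [u = G y]. The strict estimate gives [|u - u0| <= 2 K |y - F u0|], after
    which the error of the linearization of [G] is, up to [J^-1], the error of
    the linearization of [F], which is negligible. *)
Lemma inverse_is_diff m (V : set 'rV[R]_m) (F G : 'rV[R]_m -> 'rV[R]_m) u0 :
  open V -> (forall j, Ck 1 V (fun u => F u 0 j)) -> V u0 ->
  pjacobian F u0 \in unitmx -> (forall u, V u -> G (F u) = u) ->
  is_diff (F u0) G (mulmxr (invmx (pjacobian F u0))).
Proof.
move=> oV kF Vu0 Ju GF; set J := pjacobian F u0 in Ju *.
have [K K0 KB] := mulmxr_bound (invmx J).
have K20 : 0 < 2 * K by rewrite mulr_gt0.
apply: diff_of_approx => e e0.
pose e1 := Num.min (2 * K)^-1 (e / (K * (2 * K))).
have e10 : 0 < e1 by rewrite lt_min invr_gt0 K20 divr_gt0// mulr_gt0.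
have [d d0 dP] := strict_diff oV kF Vu0 e10.
have : nbhs u0 (V `&` [set u | `|u - u0| < d]).
  apply: filterI; first exact: open_nbhs_nbhs.
  by apply/(@nbhs_normP R 'rV[R]_m); exists d => // u /=; rewrite distrC.
move=> /(local_surj oV kF Vu0 Ju); apply: filterS => y [u [Vu ud] <-].
rewrite !GF//.
have u0d : `|u0 - u0| < d by rewrite subrr normr0.
have uE := dP u0 u u0d ud; rewrite -/J in uE.
have u_le : `|u - u0| <= 2 * K * `|F u - F u0|.
  have H : `|u - u0| <= K * (`|F u - F u0| + (2 * K)^-1 * `|u - u0|).
    rewrite -[in leLHS](mulmxK Ju (u - u0)); apply: le_trans (KB _) _.
    rewrite ler_pM2l//.
    rewrite (_ : (u - u0) *m J =
        (F u - F u0) - (F u - F u0 - (u - u0) *m J)); last first.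
      by rewrite opprB addrCA subrr addr0.
    apply: le_trans (ler_normB _ _) _; rewrite lerD2l; apply: le_trans uE _.
    by rewrite ler_wpM2r// ge_min lexx.
  move: H; rewrite mulrDr mulrA (_ : K * (2 * K)^-1 = 2^-1); last first.
    by field; rewrite gt_eqF.
  by lra.
rewrite (_ : u - u0 - _ = - ((F u - F u0 - (u - u0) *m J) *m invmx J)); last first.
  by rewrite [in RHS]mulmxBl mulmxK// opprB.
rewrite normrN; apply: le_trans (KB _) _.
apply: (@le_trans _ _ (K * (e / (K * (2 * K)) * (2 * K * `|F u - F u0|)))).
  rewrite ler_pM2l//; apply: le_trans uE _; apply: ler_pM => //; first exact: ltW.
  by rewrite ge_min lexx orbT.
rewrite le_eqVlt; apply/orP; left; apply/eqP; field.
by rewrite gt_eqF.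
Qed.

Lemma Ck_bigsum k m (U : set 'rV[R]_m) (I : Type) (s : seq I)
    (f : I -> 'rV[R]_m -> R) : open U -> (forall i, Ck k U (f i)) ->
  Ck k U (fun u => \sum_(i <- s) f i u).
Proof.
move=> oU kf; elim: s => [|i s IH].
  apply: (eq_Ck oU _ (Ck_cst k U 0)) => u _; by rewrite big_nil.
apply: (eq_Ck oU _ (CkD oU (kf i) IH)) => u _; by rewrite big_cons.
Qed.

Lemma Ck_bigprod k m (U : set 'rV[R]_m) (I : Type) (s : seq I)
    (f : I -> 'rV[R]_m -> R) : open U -> (forall i, Ck k U (f i)) ->
  Ck k U (fun u => \prod_(i <- s) f i u).
Proof.
move=> oU kf; elim: s => [|i s IH].
  apply: (eq_Ck oU _ (Ck_cst k U 1)) => u _; by rewrite big_nil.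
apply: (eq_Ck oU _ (CkM oU (kf i) IH)) => u _; by rewrite big_cons.
Qed.

Lemma Ck_det k m (U : set 'rV[R]_m) p (A : 'rV[R]_m -> 'M[R]_p) : open U ->
  (forall i j, Ck k U (fun u => A u i j)) -> Ck k U (fun u => \det (A u)).
Proof.
move=> oU kA; apply: Ck_bigsum => [|s]; first exact: oU.
apply: CkM; [exact: oU|exact: Ck_cst|].
by apply: Ck_bigprod => [|i]; [exact: oU|exact: kA].
Qed.

Lemma Ck_invmx k m (U : set 'rV[R]_m) p (A : 'rV[R]_m -> 'M[R]_p) i j : open U ->
  (forall i j, Ck k U (fun u => A u i j)) -> (forall u, U u -> A u \in unitmx) ->
  Ck k U (fun u => invmx (A u) i j).
Proof.
move=> oU kA uA.
apply: (@eq_Ck _ _ _ _ (fun u => (\det (A u))^-1 * ((-1) ^+ (j + i) *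
    \det (row' j (col' i (A u)))))) => //.
  by move=> u Uu; rewrite /invmx uA// !mxE.
apply: CkM; first exact: oU.
  apply: CkV; [exact: oU| |exact: Ck_det].
  by move=> u /uA; rewrite unitmxE unitfE.
apply: CkM; [exact: oU|exact: Ck_cst|].
apply: Ck_det => [|i' j']; first exact: oU.
by apply: (eq_Ck oU _ (kA (lift j i') (lift i j'))) => u _; rewrite !mxE.
Qed.

(** The partial derivatives of [G] are the entries of the inverse of the
    Jacobian of [F], taken at [G y]. Cramer's formula makes these entries smooth
    functions on [V], so [G] being [C^k] implies that [G] is [C^(k+1)]. *)
Lemma inverse_smooth m (V : set 'rV[R]_m) (F G : 'rV[R]_m -> 'rV[R]_m) :
  open V -> smooth_on V F -> (forall u, V u -> pjacobian F u \in unitmx) ->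
  (forall u, V u -> G (F u) = u) ->
  open (F @` V) /\ smooth_on (F @` V) G.
Proof.
move=> oV sF uF GF; have kF j : Ck 1 V (fun u => F u 0 j) by exact: sF.
have oFV : open (F @` V).
  rewrite openE => y [u Vu <-]; apply: (local_surj oV kF Vu (uF u Vu)).
  exact: open_nbhs_nbhs.
have dG u : V u -> is_diff (F u) G (mulmxr (invmx (pjacobian F u))).
  by move=> Vu; exact: (inverse_is_diff oV kF Vu (uF u Vu) GF).
have cG j y : (F @` V) y -> {for y, continuous (fun y => G y 0 j)}.
  move=> [u Vu <-]; have [dd _] := dG u Vu.
  exact: (continuous_comp (differentiable_continuous dd)
    (@coord_continuous _ _ _ 0 j _)).
split => // k; elim: k => [|k IH] j; split => //; try exact: cG.
move=> i; split=> [y [u Vu <-]|].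
  have [dd _] := dG u Vu.
  by have [] := derive_coord (delta_mx 0 i) j dd.
apply: (@eq_Ck _ _ _ _ ((fun u => invmx (pjacobian F u) i j) \o G)) => //.
  move=> y [u Vu <-] /=; rewrite GF// -(is_diff_pjacobian (dG u Vu)).
  by rewrite mxE.
apply: (Ck_comp oFV oV IH) => [|y [u Vu <-]]; last by rewrite GF.
apply: Ck_invmx => // i' j'.
have [_ dF] := sF k.+1 j'; have [_ kd] := dF i'.
by apply: (eq_Ck oV _ kd) => u _; rewrite mxE.
Qed.

End inverse_function.

(** * The mountain pass argument *)

Section mountain_pass.
Context {R : realType} {T : topologicalType}.

(** The form of connectedness used throughout: the open set [O] need only be
    relatively closed in [C]. *)
Lemma connected_sub_clopen (C O : set T) : connected C -> open O ->
  C `&` closure O `<=` O -> C `&` O !=set0 -> C `<=` O.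
Proof.
move=> cC oO clO CO; suff <- : C `&` O = C by move=> z [].
apply: cC => //; first by exists O.
exists (closure O); first exact: closed_closure.
apply/seteqP; split=> z [Cz Oz]; split => //; first exact: subset_closure.
exact: clO.
Qed.

Lemma compact_separation (A B : set T) : hausdorff_space T ->
  compact [set: T] -> closed A -> closed B -> (forall z, A z -> ~ B z) ->
  exists O, [/\ open O, A `<=` O & forall z, closure O z -> ~ B z].
Proof.
move=> hT kT cA cB AB.
have AB0 : A `&` B = set0 by apply/seteqP; split => // z [/AB].
have [U [V [oU oV AU BV UV0]]] :=
  (@normal_openP R T).1 (compact_normal hT kT) A B cA cB AB0.
exists U; split => // z clU /BV Vz.
have [w] := clU V (open_nbhs_nbhs (conj oV Vz)).
by rewrite UV0.
Qed.

Variable g : T -> R.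
Hypothesis T_hausdorff : hausdorff_space T.
Hypothesis T_compact : compact [set: T].
Hypothesis g_continuous : continuous g.

Let above (t : R) : set T := [set z | t < g z].

Let above_open t : open (above t).
Proof.
apply: (@open_comp _ _ g [set y | t < y]); last exact: open_gt.
by move=> z _; exact: g_continuous.
Qed.

(** The frontier of [O] is compact, so a continuous function that is smaller
    than [t] on it is bounded there by some [s < t]. *)
Let frontier_level (O : set T) (t : R) : open O ->
  (forall z, closure O z -> ~ O z -> g z < t) ->
  exists2 s, s < t & forall z, closure O z -> ~ O z -> g z <= s.
Proof.
move=> oO gt; pose K := closure O `&` ~` O.
have kK : compact K.
  apply: subclosed_compact T_compact _ => //.
  by apply: closedI; [exact: closed_closure|exact: open_closedC].
have [K0|/nonemptyPn K0] := pselect (K !=set0).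
  have [c /set_mem [clc Oc] cmax] := compact_EVT_max K0 kK
    (continuous_subspaceT g_continuous).
  exists (g c); first exact: gt.
  by move=> z clz Oz; apply: cmax; apply/mem_set.
exists (t - 1); first by rewrite ltrBlDr ltrDl.
by move=> z clz Oz; have : K z by []; rewrite K0.
Qed.

Variables (m : R) (a b : T).
Hypothesis T_connected : connected [set: T].
Hypothesis T_locally_connected : forall (z : T) W, nbhs z W ->
  exists C, [/\ nbhs z C, C `<=` W & connected C].
Hypothesis above_connected : forall z : T, g z < m ->
  exists2 C, nbhs z C & connected (C `&` above (g z)).
Hypothesis above_closure : forall z : T, g z < m -> closure (above (g z)) z.
Hypothesis ga : g a = m.
Hypothesis gb : g b = m.
Hypothesis a_strict : \forall z \near a, z <> a -> g z < m.

(** Prevents any connected set strictly above level [t] from containing both [a]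
    and [b]. Open sets are used instead of connected sets so that compactness of
    the frontier can lower the level. *)
Let separated_at (t : R) := exists O, [/\ open O, O a, ~ O b &
  forall z, closure O z -> ~ O z -> g z <= t].

Let separated_near_top : a <> b -> exists2 t, t < m & separated_at t.
Proof.
move=> ab; have [W [oW Wa] Wm] : exists2 W, open_nbhs a W &
    W `<=` [set z | z <> a -> g z < m].
  by move: a_strict; rewrite -nbhs_nearE nbhsE.
have c1 (z : T) : closed [set z] by apply: compact_closed => //; exact: compact_set1.
have [|||O [oO aO clO]] :=
  @compact_separation [set a] (~` W `|` [set b]) T_hausdorff T_compact.
- exact: c1.
- by apply: closedU; [exact: open_closedC|exact: c1].
- by move=> z -> [].
(* The open set around [a] is small enough for [a] to be the only point of its
   closure at level [m]. *)
have [|s sm sP] := @frontier_level O m oO.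
  move=> z clz Oz; have /not_orP[/contrapT Wz zb] := clO z clz.
  by apply: (Wm z Wz) => za; apply: Oz; rewrite za; exact: aO.
exists s => //; exists O; split => //; first exact: aO.
by move=> /subset_closure /clO; apply; right.
Qed.

(** The heart of the argument: no pass is found at level [t]. The part above
    [t] splits into its traces inside and outside [O]. Their closures cannot
    meet: a common point would be at level [t], and near it the part above [t]
    is connected, so it cannot have points on both sides. Since every point at
    level [t] adheres to the part above [t], these two disjoint compact sets
    cover the part at level at least [t], and they can be separated by an open
    set whose frontier is strictly below level [t]. *)
Let separated_lower t : t < m -> separated_at t -> exists2 s, s < t & separated_at s.
Proof.
move=> tm [ O [oO Oa Ob dO]].
pose K1 := closure (O `&` above t); pose K2 := closure (above t `\` O).
have level z : closure (above t) z -> t <= g z.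
  have cl : closed [set z | t <= g z].
    apply: (@closed_comp _ _ g [set y | t <= y]); last exact: closed_ge.
    by move=> w _; exact: g_continuous.
  move=> clz; suff : closure [set z | t <= g z] z.
    by rewrite -((closure_id _).1 cl).
  by apply: closureS clz => w /ltW.
have K1E z : K1 z -> t < g z -> O z.
  move=> K1z tz; have clO : closure O z by apply: closureS K1z => w [].
  by apply: contrapT => /(dO z clO); rewrite leNgt tz.
have K2E z : K2 z -> t < g z -> ~ O z.
  move=> K2z tz Oz; have [w [[_ nOw] Ow]] := K2z _ (open_nbhs_nbhs (conj oO Oz)).
  exact: nOw.
(* No point at level [t] adheres to both sides. *)
have K12 z : K1 z -> ~ K2 z.
  move=> K1z K2z; have tz : t <= g z by apply: level; apply: closureS K1z => w [].
  have [tz'|zt] := ltrP t (g z); first exact: (K2E z K2z tz' (K1E z K1z tz')).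
  have {}tz : g z = t by apply/le_anti; rewrite tz zt.
  have [|C Cz cC] := @above_connected z; first by rewrite tz.
  rewrite tz in cC.
  have [w1 [[Ow1 aw1] Cw1]] := K1z C Cz.
  have [w2 [[aw2 Ow2] Cw2]] := K2z C Cz.
  apply: Ow2; apply: (connected_sub_clopen cC oO) => //; last by exists w1.
  move=> w [[_ aw] clw]; apply: contrapT => /(dO w clw).
  by rewrite leNgt aw.
have [||O1 [oO1 K1O1 clO1]] :=
  @compact_separation K1 K2 T_hausdorff T_compact _ _ K12.
- exact: closed_closure.
- exact: closed_closure.
have clA z : closure (above t) z -> K1 z \/ K2 z.
  rewrite (_ : above t = (O `&` above t) `|` (above t `\` O)) ?closureU//.
  apply/seteqP; split=> w; last by case=> -[].
  by have [Ow|Ow] := pselect (O w); [left|right].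
have top z : g z = m -> above t z by rewrite /above /= => ->.
have [|s st sP] := @frontier_level O1 t oO1.
  move=> z clz O1z; rewrite ltNge; apply/negP => tz.
  have : closure (above t) z.
    have [tz'|zt] := ltrP t (g z); first exact: subset_closure.
    have {}tz : g z = t by apply/le_anti; rewrite tz zt.
    by rewrite -tz; apply: above_closure; rewrite tz.
  by case/clA => [/K1O1//|]; exact: clO1.
exists s => //; exists O1; split => //.
  by apply: K1O1; apply: subset_closure; split => //; exact: top.
move=> /subset_closure /clO1; apply; apply: subset_closure.
by split => //; exact: top.
Qed.

Let component s := connected_component (above s) a.

Let component_mono s t : t <= s -> component s `<=` component t.
Proof.
move=> ts z Cz; have Ca : component s a.
  by apply: connected_component_refl; case: Cz => C [Ca /(_ _ Ca)].
apply: (@connected_component_max _ (above t) (component s)) Cz => //.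
  by move=> w /connected_component_sub; exact: le_lt_trans.
exact: component_connected.
Qed.

Let component_absorb s C z : connected C -> C `<=` above s -> C z ->
  component s z -> C `<=` component s.
Proof.
move=> cC Cs Cz sz; rewrite /component (same_connected_component sz).
exact: connected_component_max.
Qed.

(** The union over [s > t] of the components of [a] in the parts above [s] is a
    separating set at level [t]. It is open by local connectedness; a point of
    its frontier above level [t] would have a connected neighbourhood above some
    [s > t], which would be absorbed by the component. *)
Let separated_limit t : t < m -> (forall s, t < s -> s < m -> separated_at s) ->
  separated_at t.
Proof.
move=> tm sep; pose O := [set z | exists2 s, t < s & component s z].
exists O; split.
- rewrite openE => z [s ts sz].
  have zs : above s z by exact: connected_component_sub sz.
  have [C [zC Cs cC]] := T_locally_connected (open_nbhs_nbhs (conj (above_open s) zs)).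
  apply: filterS (zC) => w Cw; exists s => //.
  exact: (component_absorb cC Cs (nbhs_singleton zC) sz).
- exists ((t + m) / 2); first by rewrite midf_lt.
  by apply: connected_component_refl; rewrite /above /= ga midf_lt.
- move=> [s ts sb].
  have sm : s < m by rewrite -gb; exact: connected_component_sub sb.
  have sa : component s a by apply: connected_component_refl; rewrite /above /= ga.
  have [U [oU Ua Ub dU]] := sep s ts sm.
  apply: Ub; apply: (connected_sub_clopen (@component_connected _ (above s) a) oU) sb.
    move=> w [/connected_component_sub aw clw]; apply: contrapT => /(dU w clw).
    by rewrite leNgt aw.
  by exists a.
- move=> z clz Oz; rewrite leNgt; apply/negP => tz; apply: Oz.
  pose s' := (t + g z) / 2.
  have zs' : above s' z by rewrite /above /= midf_lt.
  have [C [zC Cs cC]] := T_locally_connected (open_nbhs_nbhs (conj (above_open s') zs')).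
  have [w [[s ts sw] Cw]] := clz C zC.
  pose s'' := Num.min s s'.
  exists s''; first by rewrite lt_min ts midf_lt.
  have Cs'' : C `<=` above s''.
    by move=> y /Cs; apply: le_lt_trans; rewrite ge_min lexx orbT.
  apply: (component_absorb cC Cs'' Cw _ (nbhs_singleton zC)).
  by apply: component_mono sw; rewrite ge_min lexx.
Qed.

Let separated_bound t : separated_at t -> exists z, g z <= t.
Proof.
move=> [ O [oO Oa Ob dO]]; apply: contrapT => H; apply: Ob.
apply: (connected_sub_clopen T_connected oO) => //; last by exists a.
by move=> w [_ clw]; apply: contrapT => /(dO w clw) gw; apply: H; exists w.
Qed.

(** The infimum of the levels at which [a] and [b] are separated would itself be
    such a level, by [separated_limit], and it could be lowered, by
    [separated_lower]. It is finite because a separation at a level below the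
    minimum of [g] would disconnect the space. *)
Lemma unique_summit : a = b.
Proof.
apply: contrapT => ab; pose A := [set t | t < m /\ separated_at t].
have A0 : A !=set0 by have [t tm st] := separated_near_top ab; exists t.
have [zmin _ gmin] := compact_EVT_min (ex_intro _ a I : [set: T] !=set0) T_compact
    (continuous_subspaceT g_continuous).
have lA : has_lbound A.
  exists (g zmin) => t [_ /separated_bound[z]]; apply: le_trans.
  by apply: gmin; exact: mem_set.
have t0m : inf A < m.
  have [t At] := A0; apply: le_lt_trans (ge_inf lA At) _.
  by case: At.
have St0 : separated_at (inf A).
  apply: separated_limit => // s As sm.
  have [t [_ [ O [oO Oa Ob dO]]] ts] := inf_lt A0 As.
  exists O; split => // z clz Oz; apply: le_trans (ltW ts).
  exact: dO.
have [s st Ss] := separated_lower t0m St0.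
have : inf A <= s by apply: ge_inf => //; split => //; exact: lt_trans t0m.
by rewrite leNgt st.
Qed.

End mountain_pass.

(** * Connected sets and local inverses *)

Section convex_connected.
Context {R : realType}.

Lemma convex_connected m (A : set 'rV[R]_m) :
  (forall u v (t : R), A u -> A v -> 0 <= t <= 1 -> A (u + t *: (v - u))) ->
  connected A.
Proof.
move=> cA; have [[u Au]|/nonemptyPn ->] := pselect (A !=set0); last exact: connected0.
pose seg v := (fun t : R => u + t *: (v - u)) @` `[0, 1].
have -> : A = \bigcup_(v in A) seg v.
  apply/seteqP; split=> [v Av|_ [v Av [t + <-]]].
    exists v => //; exists 1; first by rewrite /= in_itv /= ler01 lexx.
    by rewrite scale1r addrC subrK.
  by rewrite /= in_itv /=; exact: cA.
apply: bigcup_connected.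
  exists u => v Av; exists 0; first by rewrite /= in_itv /= ler01 lexx.
  by rewrite scale0r addr0.
move=> v Av; apply: connected_continuous_connected; first exact: segment_connected.
apply: continuous_subspaceT => t; apply: cvgD; first exact: cvg_cst.
by apply: cvgZr_tmp; exact: cvg_id.
Qed.

Lemma convex_dotr m (u v : 'rV[R]_m) (t : R) : 0 <= t <= 1 ->
  dotr (u + t *: (v - u)) (u + t *: (v - u)) <=
  (1 - t) * dotr u u + t * dotr v v.
Proof.
move=> /andP[t0 t1]; rewrite /dotr !mulr_sumr -big_split /=.
apply: ler_sum => i _; rewrite !mxE -subr_ge0.
rewrite (_ : _ - _ = t * (1 - t) * (u 0 i - v 0 i) ^+ 2); last by ring.
by rewrite mulr_ge0 ?sqr_ge0// mulr_ge0// subr_ge0.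
Qed.

Lemma convex_ball m (c : 'rV[R]_m) (e : R) u v (t : R) : 0 <= t <= 1 ->
  `|u - c| < e -> `|v - c| < e -> `|u + t *: (v - u) - c| < e.
Proof.
move=> /andP[t0 t1] ue ve.
rewrite (_ : _ - c = (1 - t) *: (u - c) + t *: (v - c)); last first.
  by apply/rowP => j; rewrite !mxE; ring.
apply: le_lt_trans (ler_normD _ _) _.
rewrite !normrZ (ger0_norm t0) ger0_norm ?subr_ge0//.
have [->|tn0] := eqVneq t 0; first by rewrite subr0 mul1r mul0r addr0.
rewrite (_ : e = (1 - t) * e + t * e); last by ring.
by apply: ler_ltD; [rewrite ler_wpM2l ?subr_ge0// ltW|rewrite ltr_pM2l// lt_def tn0].
Qed.

Lemma ball_dotr_connected m (c : 'rV[R]_m) (e s : R) :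
  connected [set u | `|u - c| < e /\ dotr u u < s].
Proof.
apply: convex_connected => u v t [ue us] [ve vs] t01; split; first exact: convex_ball.
apply: le_lt_trans (convex_dotr _ _ t01) _; case/andP: t01 => t0 t1.
have [->|tn0] := eqVneq t 0; first by rewrite subr0 mul1r mul0r addr0.
rewrite (_ : s = (1 - t) * s + t * s); last by ring.
by apply: ler_ltD; [rewrite ler_wpM2l ?subr_ge0// ltW|rewrite ltr_pM2l// lt_def tn0].
Qed.

Lemma setT_rV_connected m : connected [set: 'rV[R]_m].
Proof. exact: convex_connected. Qed.

Lemma ball_connected m (c : 'rV[R]_m) (e : R) : connected [set u | `|u - c| < e].
Proof. by apply: convex_connected => u v t ue ve t01; exact: convex_ball. Qed.

(** The punctured ball, a cube for the sup norm, is the union of the half cubes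
    on which one coordinate has a given sign. They are convex, and two half
    cubes attached to different coordinates meet. *)
Lemma punctured_ball_connected m (e : R) : (2 <= m)%N ->
  connected [set u : 'rV[R]_m | `|u| < e /\ u <> 0].
Proof.
move=> m2; set A := [set u | _].
(* [H s i] is the half cube on which coordinate [i] has sign [(-1)^s]. *)
pose H (s : bool) i := [set u : 'rV[R]_m | `|u| < e /\ 0 < (-1) ^+ s * u 0 i].
have HA s i : H s i `<=` A.
  by move=> u [ue ui]; split => // u0; move: ui; rewrite u0 mxE mulr0 ltxx.
have cH s i : connected (H s i).
  apply: convex_connected => u v t [ue us] [ve vs] t01; split.
    by rewrite -[X in `|X|]subr0; apply: convex_ball; rewrite ?subr0.
  case/andP: t01 => t0 t1; rewrite !mxE.
  rewrite (_ : _ * _ = (1 - t) * ((-1) ^+ s * u 0 i) +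
    t * ((-1) ^+ s * v 0 i)); last by ring.
  have [->|tn0] := eqVneq t 0; first by rewrite subr0 mul1r mul0r addr0.
  apply: ltr_wpDl; first by rewrite mulr_ge0 ?subr_ge0// ltW.
  by rewrite mulr_gt0// lt_def tn0.
have AH u : A u -> exists s i, H s i u.
  move=> [ue u0]; apply: contrapT => nH; apply: u0; apply/rowP => i.
  rewrite mxE; apply/eqP; rewrite eq_le !leNgt; apply/andP; split; apply/negP => ui.
    by apply: nH; exists false, i; split => //; rewrite expr0 mul1r.
  by apply: nH; exists true, i; split => //; rewrite expr1 mulN1r oppr_gt0.
have link s s' i j u v : i != j -> H s i u -> H s' j v -> connected_component A u v.
  move=> ij Hu Hv.
  have e0 : 0 < e by case: Hu => ue _; exact: le_lt_trans ue.
  pose w : 'rV[R]_m :=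
    \row_k ((e / 2) * ((-1) ^+ s *+ (k == i) + (-1) ^+ s' *+ (k == j))).
  have we : `|w| < e.
    apply: (@le_lt_trans _ _ (e / 2)); last by rewrite ltr_pdivrMr// ltr_pMr ?ltr1n.
    apply: rV_norm_le => [|k]; first by rewrite ltW// divr_gt0.
    rewrite mxE normrM ger0_norm; last by rewrite ltW// divr_gt0.
    rewrite ler_piMr//; first by rewrite ltW// divr_gt0.
    have [->|ki] := eqVneq k i.
      by rewrite (negbTE ij) mulr0n addr0 mulr1n normr_sign.
    by rewrite mulr0n add0r; case: (k == j); rewrite ?normr_sign// normr0.
  have sgn2 (b : bool) : ((-1) ^+ b * (-1) ^+ b = 1 :> R) by rewrite -expr2 sqrr_sign.
  have Hw : H s i w.
    split => //; rewrite mxE eqxx (negbTE ij) mulr0n addr0 mulr1n.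
    by rewrite mulrCA sgn2 mulr1 divr_gt0.
  have Hw' : H s' j w.
    split => //; rewrite mxE eqxx eq_sym (negbTE ij) mulr0n add0r mulr1n.
    by rewrite mulrCA sgn2 mulr1 divr_gt0.
  apply: (@connected_component_trans _ _ w).
    by apply: (@connected_component_max _ A (H s i)) => //; exact: HA.
  by apply: (@connected_component_max _ A (H s' j)) => //; exact: HA.
have all_linked u v : A u -> A v -> connected_component A u v.
  move=> /AH[s [i Hu]] /AH[s' [j Hv]].
  have [ij|] := eqVneq i j; last by move=> ij; exact: link ij Hu Hv.
  have [k ki] : exists k : 'I_m, k != i.
    case: m m2 i {H HA cH AH link Hu Hv A ij j u v} => [|[|m]]// _ i.
    exists (if i == ord0 then ord_max else ord0).
    by have [->|] := eqVneq i ord0; rewrite // eq_sym.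
  have e0 : 0 < e by case: Hu => ue _; exact: le_lt_trans ue.
  pose w : 'rV[R]_m := \row_l ((e / 2) *+ (l == k)).
  have Hw : H false k w.
    split; last by rewrite mxE eqxx mulr1n expr0 mul1r divr_gt0.
    apply: (@le_lt_trans _ _ (e / 2)); last by rewrite ltr_pdivrMr// ltr_pMr ?ltr1n.
    apply: rV_norm_le => [|l]; first by rewrite ltW// divr_gt0.
    by rewrite mxE; case: (l == k); rewrite ?normr0 ?mulr1n ?ger0_norm// ltW// divr_gt0.
  apply: (@connected_component_trans _ _ w); first by apply: link Hu Hw; rewrite eq_sym.
  by apply: link Hw Hv; rewrite -ij.
have [[u Au]|/nonemptyPn ->] := pselect (A !=set0); last exact: connected0.
suff -> : A = connected_component A u by exact: component_connected.
by apply/seteqP; split; [move=> v; exact: all_linked|exact: connected_component_sub].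
Qed.

End convex_connected.

Section local_pullback.
Context {R : realType} {n : nat} {T Y : topologicalType}.
Variable f : T -> Y.
Hypothesis f_continuous : continuous f.
Hypothesis f_open : forall (z : T) (W : set T), nbhs z W -> nbhs (f z) (f @` W).
Hypothesis f_locally_injective : forall z : T, exists2 W, nbhs z W &
  forall v w, W v -> W w -> f v = f w -> v = w.

(** An open locally injective map has continuous local sections. Composed with
    the inverse of a chart, such a section [s] is defined on a ball and its
    image is the neighbourhood [C] of [z]; connectedness of the part of the ball
    that satisfies a condition is then carried over to [C]. *)
Lemma local_pullback (c : chart n Y) (z : T) (N : set T) :
  chart_dom c (f z) -> nbhs z N ->
  exists e C, [/\ 0 < e, nbhs z C, C `<=` N &
    forall P : set Y,
      connected [set u : 'rV[R]_n | `|u - c (f z)| < e /\ P (chart_inv c u)] ->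
      connected (C `&` f @^-1` P)].
Proof.
move=> dz Nz; have [W Wz Winj] := f_locally_injective z.
pose W0 := (W `&` N)°.
have oW0 : open W0 by exact: open_interior.
have W0z : W0 z by apply: filterI.
have W0W : W0 `<=` W by move=> w /interior_subset[].
have W0N : W0 `<=` N by move=> w /interior_subset[].
have rz : (c @` chart_dom c) (c (f z)) by exists (f z).
have fW0 : nbhs (f z) (f @` W0) by apply: f_open; exact: open_nbhs_nbhs.
have : nbhs (c (f z)) ((c @` chart_dom c) `&` chart_inv c @^-1` (f @` W0)).
  apply: (@filterI _ (nbhs (c (f z)))).
    by apply: open_nbhs_nbhs; split; [exact: chart_range_open|].
  by apply: (chart_inv_cont rz); rewrite chart_funK.
move=> /(@nbhs_normP R 'rV[R]_n)[e /= e0 eP].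
pose B := [set u : 'rV[R]_n | `|u - c (f z)| < e].
(* A section of [f] over [B], read in the chart. *)
pose s u := xget z [set w | W0 w /\ f w = chart_inv c u].
have Bs u : B u -> [/\ (c @` chart_dom c) u, W0 (s u) & f (s u) = chart_inv c u].
  move=> Bu; have [] := eP u; first by rewrite /= distrC.
  move=> cu [w W0w fw]; have [] := @xgetI _ z [set w | W0 w /\ f w = chart_inv c u] w.
    by split.
  by move=> W0s fs; split.
have s_unique u w : B u -> W0 w -> f w = chart_inv c u -> s u = w.
  move=> /Bs[_ W0s fs] W0w fw; apply: Winj; [exact: W0W|exact: W0W|].
  by rewrite fs fw.
have s_cont u : B u -> {for u, continuous s}.
  move=> Bu N' N's; have [cu W0s fs] := Bs u Bu.
  have : nbhs (f (s u)) (f @` (N' `&` W0)).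
    by apply: f_open; apply: filterI => //; exact: open_nbhs_nbhs.
  rewrite fs => Nu0.
  have Nu : nbhs u (chart_inv c @^-1` (f @` (N' `&` W0))).
    exact: (chart_inv_cont cu Nu0).
  have oB : open B.
    rewrite (_ : B = ball (c (f z)) e); first exact: ball_open.
    by rewrite -ball_normE; apply/seteqP; split=> v; rewrite /B /= distrC.
  have Bu' : nbhs u B by exact: open_nbhs_nbhs.
  change (nbhs u (s @^-1` N')).
  apply: filterS (filterI Nu Bu') => v [[w [N'w W0w] fw] Bv].
  by rewrite /= (s_unique v w).
exists e, (s @` B); split => //.
- have cz : nbhs z (f @^-1` (chart_dom c `&` c @^-1` B)).
    apply: f_continuous; apply: filterI.
      by apply: open_nbhs_nbhs; split => //; exact: chart_dom_open.
    apply: (chart_fun_cont dz); apply/(@nbhs_normP R 'rV[R]_n).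
    by exists e => // u; rewrite /= distrC.
  apply: filterS (filterI cz (open_nbhs_nbhs (conj oW0 W0z))) => w [[dw Bw] W0w].
  by exists (c (f w)) => //; apply: s_unique => //; rewrite chart_funK.
- by move=> _ [u Bu <-]; have [_ ? _] := Bs u Bu; exact: W0N.
move=> P cP.
rewrite (_ : _ `&` _ = s @` [set u | B u /\ P (chart_inv c u)]).
  apply: connected_continuous_connected => //.
  by apply: continuous_in_subspaceT => u /set_mem[Bu _]; exact: s_cont.
apply/seteqP; split.
  move=> _ [[u Bu <-] Pu]; exists u => //; split => //.
  by have [_ _ <-] := Bs u Bu.
move=> _ [u [Bu Pu] <-]; split; first by exists u.
by have [_ _ fs] := Bs u Bu; rewrite /= fs.
Qed.

End local_pullback.

(** * Local homeomorphisms to a sphere *)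

Section sphere_height.
Context {R : realType} {n : nat}.

Definition height (y : sphere R n) : R := (val y : 'rV[R]_n.+1) 0 0.

Lemma height_continuous : continuous height.
Proof. exact: sphere_coord_cont. Qed.

Lemma height_sqr (y : sphere R n) :
  height y ^+ 2 + dotr (rsubmx (val y : 'rV[R]_(1 + n)))
    (rsubmx (val y : 'rV[R]_(1 + n))) = 1.
Proof.
rewrite -(dotr_row_mx (row_split (val y : 'rV[R]_n.+1))).
exact: (set_mem (valP y)).
Qed.

Lemma height_bounds (y : sphere R n) : -1 <= height y <= 1.
Proof.
have := height_sqr y; have := dotr_ge0 (rsubmx (val y : 'rV[R]_(1 + n))).
move=> d0 h2; have : height y ^+ 2 <= 1 by rewrite -h2 lerDl.
by move=> h1; rewrite -ler_norml -(@expr_le1 _ 2)// real_normK ?num_real.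
Qed.

Lemma height_pole (y : sphere R n) : height y ^+ 2 = 1 ->
  rsubmx (val y : 'rV[R]_(1 + n)) = 0.
Proof.
move=> h1; apply: dotr_eq0; have := height_sqr y; rewrite h1 => /eqP.
by rewrite -subr_eq0 addrAC subrr add0r => /eqP.
Qed.

(** At heights 1 and -1 the other coordinates vanish. *)
Lemma height_pole_inj (y y' : sphere R n) : height y ^+ 2 = 1 ->
  height y = height y' -> y = y'.
Proof.
move=> h1 hh; apply: val_inj.
rewrite (row_split (val y : 'rV[R]_n.+1)) (row_split (val y' : 'rV[R]_n.+1)).
by rewrite !height_pole -?hh// -!/(height _) hh.
Qed.

Lemma height_stereo_inv b (u : 'rV[R]_n) : height (stereo_inv b u) =
  (-1) ^+ b * ((dotr u u - 1) / (dotr u u + 1)).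
Proof. exact: row_mx_head. Qed.

(** Seen from the north pole, a superlevel set of the height is a Euclidean
    ball, hence convex. *)
Lemma height_gt_north (u : 'rV[R]_n) (t : R) : -1 < t ->
  (t < height (stereo_inv true u)) = (dotr u u < (1 - t) / (1 + t)).
Proof.
move=> t1; have d0 := dotr_ge0 u.
rewrite height_stereo_inv expr1 mulN1r -mulNr opprB.
rewrite !ltr_pdivlMr; [|by lra|by lra].
by apply/idP/idP; lra.
Qed.

(** At the lowest level the relevant chart is centered at the south pole, where
    the superlevel set is the complement of the center. *)
Lemma height_gt_south (u : 'rV[R]_n) :
  (-1 < height (stereo_inv false u)) <-> u <> 0.
Proof.
have d0 := dotr_ge0 u.
rewrite height_stereo_inv expr0 mul1r ltr_pdivlMr; last by lra.
split=> [+ u0|u0].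
  by rewrite u0 /dotr big1 ?add0r ?sub0r ?mulr1 ?ltxx// => j _; rewrite mxE mul0r.
suff : dotr u u != 0 by move/eqP; lra.
by apply/eqP => /dotr_eq0.
Qed.

Lemma sphere_hausdorff : hausdorff_space (sphere R n).
Proof.
move=> y y' yy'; apply: val_inj; apply: (@norm_hausdorff R 'rV[R]_n.+1).
have cv : continuous (set_val : sphere R n -> 'rV[R]_n.+1) by exact: initial_continuous.
move=> A B Ay By'; have [z [Az Bz]] := yy' _ _ (cv y A Ay) (cv y' B By').
by exists (val z).
Qed.

Lemma sphere_connected : (0 < n)%N -> connected [set: sphere R n].
Proof.
move=> n0; pose C b := range (@stereo_inv R n b).
have cC b : connected (C b).
  apply: connected_continuous_connected; first exact: setT_rV_connected.
  by apply: continuous_subspaceT; exact: stereo_inv_cont.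
have CE b (y : sphere R n) : stereo_dom b y -> C b y.
  by move=> /stereoK <-; exists (stereo b y).
have CU : C true `|` C false = [set: sphere R n].
  apply/seteqP; split => // y _.
  have [h1|h1] := eqVneq (height y) 1; last first.
    by right; apply: CE; rewrite /stereo_dom /= expr0.
  left; apply: CE; rewrite /stereo_dom /= expr1 -/(height y) h1 -subr_eq0 opprK.
  by apply: lt0r_neq0; lra.
rewrite -CU; apply: connectedU => //.
pose u : 'rV[R]_n := const_mx 1.
exists (stereo_inv false u); split; last by exists u.
apply: CE; rewrite /stereo_dom /= expr1 -/(height (stereo_inv false u)) gt_eqF//.
apply/height_gt_south => /rowP /(_ (Ordinal n0)).
by rewrite !mxE => /eqP; rewrite oner_eq0.
Qed.

End sphere_height.

Section sphere_cover.
Context {R : realType} {n : nat} {T : topologicalType}.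
Variable f : T -> sphere R n.
Hypothesis n_ge2 : (2 <= n)%N.
Hypothesis T_hausdorff : hausdorff_space T.
Hypothesis T_compact : compact [set: T].
Hypothesis T_connected : connected [set: T].
Hypothesis f_continuous : continuous f.
Hypothesis f_open : forall (z : T) (W : set T), nbhs z W -> nbhs (f z) (f @` W).
Hypothesis f_locally_injective : forall z : T, exists2 W, nbhs z W &
  forall v w, W v -> W w -> f v = f w -> v = w.

Let g (z : T) : R := height (f z).

Let g_continuous : continuous g.
Proof.
move=> z; apply: continuous_comp; first exact: f_continuous.
exact: height_continuous.
Qed.

Let pullback c z N :=
  @local_pullback R n T _ f f_continuous f_open f_locally_injective c z N.

Let locally_connected (z : T) W : nbhs z W ->
  exists C, [/\ nbhs z C, C `<=` W & connected C].
Proof.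
move=> zW; have [c _ cz] := stereo_cover (f z).
have [e [C [e0 zC CW cC]]] := pullback cz zW.
exists C; split => //; rewrite -[C]setIT -(preimage_setT f).
apply: cC; rewrite (_ : [set u | _] = [set u | `|u - c (f z)| < e]).
  exact: ball_connected.
by apply/seteqP; split=> u //; case.
Qed.

Let north_dom z : -1 < g z -> stereo_dom true (f z).
Proof. by move=> gz; rewrite /stereo_dom /= expr1 -/(height (f z)) gt_eqF. Qed.

Let south_dom z : g z = -1 -> stereo_dom false (f z).
Proof.
move=> gz; rewrite /stereo_dom /= expr0 -/(height (f z)) -/(g z) gz lt_eqF//.
Qed.

Let south_center z : g z = -1 -> stereo false (f z) = 0.
Proof.
move=> gz; rewrite /stereo /= height_pole ?scaler0//.
by rewrite -/(g z) gz sqrrN expr1n.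
Qed.

Let g_low z : g z < 1 -> g z = -1 \/ -1 < g z.
Proof.
move=> gz; have /andP[+ _] := height_bounds (f z).
by rewrite -/(g z) le_eqVlt => /orP[/eqP|]; [left|right].
Qed.

(** In the stereographic chart centered at the north pole the set above a level
    greater than -1 is the intersection of two convex sets. Over the south pole
    it is a punctured ball. *)
Let above_connected (z : T) : g z < 1 ->
  exists2 C, nbhs z C & connected (C `&` [set w | g z < g w]).
Proof.
move=> /g_low[gz|gz].
  have [e [C [e0 zC _ cC]]] :=
    @pullback (@stereo_chart R n false) z setT (south_dom gz) filterT.
  exists C => //; apply: (cC [set y | g z < height y]).
  rewrite /= (south_center gz) (_ : [set u | _] = [set u | `|u| < e /\ u <> 0]).
    exact: punctured_ball_connected.
  by apply/seteqP; split=> u /=; rewrite subr0 gz => -[ue hu]; split => //;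
    exact/height_gt_south.
have [e [C [e0 zC _ cC]]] :=
  @pullback (@stereo_chart R n true) z setT (north_dom gz) filterT.
exists C => //; apply: (cC [set y | g z < height y]).
rewrite /= (_ : [set u | _] = [set u | `|u - stereo true (f z)| < e /\
    dotr u u < (1 - g z) / (1 + g z)]); first exact: ball_dotr_connected.
by apply/seteqP; split=> u /= [ue]; rewrite height_gt_north.
Qed.

(** Local paths of the sphere lift to accumulation points because [f] is
    open. *)
Let closure_path (z : T) (b : bool) (v : 'rV[R]_n) (t : R) :
  stereo_dom b (f z) ->
  (\forall s \near 0^'+, t < height (stereo_inv b (stereo b (f z) + s *: v))) ->
  closure [set w | t < g w] z.
Proof.
move=> dz tP N zN.
pose gam (s : R) := stereo_inv b (stereo b (f z) + s *: v).
have cgam : {for 0, continuous gam}.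
  apply: (@continuous_comp _ _ _ (fun s : R => stereo b (f z) + s *: v));
    last exact: stereo_inv_cont.
  by apply: cvgD; [exact: cvg_cst|apply: cvgZr_tmp; exact: cvg_id].
have gam0 : gam 0 = f z by rewrite /gam scale0r addr0 stereoK.
have nN : nbhs (gam 0) (f @` N) by rewrite gam0; exact: f_open.
have N0' : \forall s \near 0^'+, (f @` N) (gam s).
  exact: (cvg_at_right_filter cgam nN).
have [s [ts [w Nw fw]]] := filter_ex (filterI tP N0').
by exists w; split => //; rewrite /= /g fw.
Qed.

(** The height has no local maximum besides the north pole: in the chart one can
    always move towards the origin, or away from it at the south pole. *)
Let above_closure (z : T) : g z < 1 -> closure [set w | g z < g w] z.
Proof.
move=> gz1; have [gz|gz] := g_low gz1.
  apply: (@closure_path z false (const_mx 1)); first exact: south_dom.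
  rewrite gz south_center//; near=> s.
  apply/height_gt_south; rewrite add0r => /rowP /(_ (Ordinal (ltnW n_ge2))).
  rewrite !mxE mulr1 => s0.
  have : 0 < s by near: s; exact: nbhs_right_gt.
  by rewrite s0 ltxx.
apply: (@closure_path z true (- stereo true (f z))); first exact: north_dom.
set u0 := stereo true (f z).
have u0E : f z = stereo_inv true u0 by rewrite stereoK//; exact: north_dom.
near=> s.
have s0 : 0 < s by near: s; exact: nbhs_right_gt.
have s1 : s < 1 by near: s; apply: nbhs_right_lt.
have d_ge0 := dotr_ge0 u0.
have u0d : dotr u0 u0 = (1 - g z) / (1 + g z).
  have hg : g z * (dotr u0 u0 + 1) = 1 - dotr u0 u0.
    rewrite /g u0E height_stereo_inv expr1 -mulrA divfK ?mulN1r ?opprB//.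
    by apply: lt0r_neq0; lra.
  have g1 : 1 + g z != 0 by apply: lt0r_neq0; lra.
  by apply: (canRL (mulfK g1)); lra.
have d_gt0 : 0 < dotr u0 u0 by rewrite u0d divr_gt0//; lra.
rewrite height_gt_north// -u0d.
rewrite (_ : u0 + _ = (1 - s) *: u0); last by rewrite scalerBl scale1r scalerN.
rewrite dotrZ gtr_pMl// expr_lt1//; lra.
Unshelve. all: by end_near. Qed.

(** The set [D] of the points with several preimages is open because [f] is
    open, and compact because [f] is locally injective, which keeps pairs of
    distinct points in a fibre away from the diagonal. The sphere being
    connected, [D] is empty or contains the north pole, and the latter is
    excluded by [unique_summit]. *)
Lemma sphere_cover_injective (a b : T) : f a = f b -> a = b.
Proof.
move=> fab; apply: contrapT => ab.
pose P := [set p : T * T | f p.1 = f p.2 /\ p.1 <> p.2].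
pose D := (fun p : T * T => f p.1) @` P.
have cP : closed P.
  rewrite -[P]setCK; apply: open_closedC; rewrite openE => -[v w] nP.
  have [fvw|fvw] := eqVneq (f v) (f w).
    have vw : v = w by apply: contrapT => vw; exact: nP.
    have [W Wv Winj] := f_locally_injective v.
    rewrite -vw; exists (W, W) => // -[v' w'] [/= Wv' Ww'] [/= fvw' vw'].
    by apply: vw'; exact: Winj.
  have := @sphere_hausdorff R n; rewrite open_hausdorff => /(_ _ _ fvw).
  move=> [[A B] /= [/set_mem Av /set_mem Bw] [oA oB /eqP AB0]].
  exists (f @^-1` A, f @^-1` B).
    by split; apply: f_continuous; exact: open_nbhs_nbhs.
  move=> -[v' w'] [/= Av' Bw'] [/= fvw' _].
  have : (A `&` B) (f v') by split; rewrite ?fvw'//; rewrite -fvw'.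
  by rewrite AB0.
have kP : compact P.
  apply: subclosed_compact cP _ (@subsetT _ _).
  by rewrite -setXTT; exact: compact_setX.
have kD : compact D.
  apply: continuous_compact kP; apply: continuous_subspaceT => p.
  by apply: continuous_comp; [exact: cvg_fst|exact: f_continuous].
have cD : closed D by apply: compact_closed kD; exact: sphere_hausdorff.
have oD : open D.
  rewrite openE => _ [[v w] [/= fvw /eqP vw] <-].
  have := T_hausdorff; rewrite open_hausdorff => /(_ _ _ vw).
  move=> [[A B] /= [/set_mem Av /set_mem Bw] [oA oB /eqP AB0]].
  have fA : nbhs (f v) (f @` A) by apply: f_open; exact: open_nbhs_nbhs.
  have fB : nbhs (f v) (f @` B) by rewrite fvw; apply: f_open; exact: open_nbhs_nbhs.
  apply: filterS (filterI fA fB) => y [[v' Av' fv'] [w' Bw' fw']].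
  exists (v', w') => //; split => /=; first by rewrite fv' fw'.
  move=> vw'; have : (A `&` B) v' by split => //; rewrite vw'.
  by rewrite AB0.
have DT : [set: sphere R n] `<=` D.
  apply: connected_sub_clopen => //.
  - by apply: sphere_connected; exact: ltnW.
  - by rewrite setTI -((closure_id _).1 cD).
  - by exists (f a); split => //; exists (a, b).
pose north : sphere R n := stereo_inv true 0.
have hn : height north = 1.
  rewrite height_stereo_inv /dotr big1; last by move=> j _; rewrite mxE mul0r.
  by rewrite sub0r add0r divr1 expr1 mulN1r opprK.
have [[v w] [/= fvw vw] fv] := DT north I.
apply: vw.
have gv : g v = 1 by rewrite /g fv.
apply: (@unique_summit R T g T_hausdorff T_compact g_continuous 1 v w) => //.
  by rewrite /g -fvw fv.
have [W Wv Winj] := f_locally_injective v.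
apply: filterS (Wv) => z Wz zv; rewrite lt_neqAle; apply/andP; split; last first.
  by have /andP[] := height_bounds (f z).
apply/eqP => gz; apply: zv; apply: Winj => //; first exact: nbhs_singleton.
by apply: height_pole_inj; rewrite -!/(g _) gz ?expr1n// gv.
Qed.

Lemma sphere_cover_surjective (a : T) (y : sphere R n) : exists z, f z = y.
Proof.
suff : [set: sphere R n] `<=` range f by move=> /(_ y I)[z _ <-]; exists z.
have kf : compact (range f).
  by apply: continuous_compact => //; exact: continuous_subspaceT.
apply: connected_sub_clopen => //.
- by apply: sphere_connected; exact: ltnW.
- rewrite openE => _ [z _ <-]; apply: f_open; exact: filterT.
- rewrite setTI -((closure_id _).1 _)//.
  by apply: compact_closed kf; exact: sphere_hausdorff.
- by exists (f a); split => //; exists a.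
Qed.

End sphere_cover.

(** * Smooth maps to spheres and local diffeomorphisms *)

Section smooth_maps_to_spheres.
Context {R : realType} {n : nat} {M : topologicalType}.
Variable A : atlas R n M.

Lemma chart_image_open m (T : topologicalType) (c : @chart R m T) (W : set T) :
  open W -> open (c @` (chart_dom c `&` W)).
Proof.
move=> oW; rewrite openE => _ [p [cp Wp] <-].
have rp : (c @` chart_dom c) (c p) by exists p.
have N1 : nbhs (c p) (c @` chart_dom c).
  by apply: open_nbhs_nbhs; split => //; exact: chart_range_open.
have N2 : nbhs (c p) (chart_inv c @^-1` W).
  apply: (chart_inv_cont rp); rewrite chart_funK//.
  exact: open_nbhs_nbhs.
apply: filterS (filterI N1 N2) => _ [[q cq <-] /=]; rewrite chart_funK// => Wq.
by exists q.
Qed.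

(** Smoothness into the sphere amounts to smoothness of the Euclidean
    coordinates: here because the inverses of the stereographic charts are
    smooth, and in [smooth_map_sphere] because these charts are rational
    functions of the coordinates. *)
Lemma sphere_chart_smooth q (h : M -> sphere R q) (c : chart n M) :
  smooth_map A (sphere_atlas R q) h -> charts A c ->
  smooth_on (c @` chart_dom c) (fun u => val (h (chart_inv c u)) : 'rV[R]_q.+1).
Proof.
move=> [ch sh] Ac k j; apply: Ck_local => _ [p cp <-].
have [d [b _ db] dp] := stereo_cover (h p).
pose U := c @` (chart_dom c `&` h @^-1` (chart_dom d)).
have oU : open U.
  apply: chart_image_open; apply: open_comp; last exact: chart_dom_open.
  by move=> w _; exact: ch.
exists U; first by exists p.
have kd := sh c d Ac (ex_intro2 _ _ b I db).
apply: (eq_Ck oU (f := (fun v => stereo_inv_fun b v 0 j) \o (d \o h \o chart_inv c))).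
  move=> _ [w [cw dw] <-]; rewrite /= chart_funK//.
  have := chart_funK dw; rewrite -db /= => /(congr1 val) /=.
  by move=> ->.
apply: (Ck_comp oU openT (kd k) (stereo_inv_smooth b k j)).
by [].
Qed.

Lemma chart_smooth_continuous q (h : M -> 'rV[R]_q) :
  (forall c, charts A c -> smooth_on (c @` chart_dom c) (h \o chart_inv c)) ->
  continuous h.
Proof.
move=> sh p; have [c Ac cp] := charts_cover A p.
have rp : (c @` chart_dom c) (c p) by exists p.
have ch : {for c p, continuous (h \o chart_inv c)}.
  by apply: cvg_rV => j; exact: (Ck_cont (sh c Ac 0%N j)).
apply: (@near_eq_continuous_at _ _ ((h \o chart_inv c) \o c)).
  apply: filterS (open_nbhs_nbhs (conj (chart_dom_open c) cp)) => w cw.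
  by rewrite /= chart_funK.
by apply: continuous_comp; [exact: chart_fun_cont|].
Qed.

Lemma smooth_map_sphere q (h : M -> sphere R q) :
  (forall c, charts A c -> smooth_on (c @` chart_dom c)
     (fun u => val (h (chart_inv c u)) : 'rV[R]_q.+1)) ->
  smooth_map A (sphere_atlas R q) h.
Proof.
move=> sh; have ch : continuous h.
  by apply: continuous_comp_initial; exact: chart_smooth_continuous.
split => // c _ Ac [b _ <-].
set U := c @` _; have oU : open U.
  apply: chart_image_open; apply: open_comp; last exact: chart_dom_open.
  by move=> w _; exact: ch.
have UV : U `<=` c @` chart_dom c by move=> _ [w [cw _] <-]; exists w.
have kh k j : Ck k U (fun u => (val (h (chart_inv c u)) : 'rV[R]_q.+1) 0 j).
  by apply: (smooth_on_sub UV); exact: sh.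
move=> k j.
pose f (u : 'rV[R]_n) :=
  (1 + - (-1) ^+ b * (val (h (chart_inv c u)) : 'rV[R]_q.+1) 0 0)^-1 *
  (val (h (chart_inv c u)) : 'rV[R]_q.+1) 0 (rshift 1 j).
apply: (@eq_Ck _ _ _ _ f) => // [u _|].
  by rewrite /f /= /stereo [RHS]mxE mulNr; congr (_ * _); rewrite [RHS]mxE.
apply: CkM => //; apply: CkV => // [_ [w [cw dw] <-]|].
  by rewrite chart_funK// mulNr; exact: stereo_dom_denom.
apply: CkD => //; first exact: Ck_cst.
by apply: CkM => //; exact: Ck_cst.
Qed.

End smooth_maps_to_spheres.

Section local_diffeomorphism.
Context {R : realType} {n : nat} {M : topologicalType}.
Variables (A : atlas R n M) (f : M -> sphere R n).
Hypothesis f_smooth : smooth_map A (sphere_atlas R n) f.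

(** Stated with Euclidean coordinates in the target, so that it can be checked
    without charts of the sphere. *)
Definition immersive_to_sphere := forall c p, charts A c -> chart_dom c p ->
  forall w : 'rV[R]_n, w *m pjacobian
    (fun u => val (f (chart_inv c u)) : 'rV[R]_n.+1) (c p) = 0 -> w = 0.
Hypothesis f_immersive : immersive_to_sphere.

Let overlap (c : @chart R n M) (d : @chart R n (sphere R n)) :=
  c @` (chart_dom c `&` f @^-1` chart_dom d).

Let overlap_open c d : open (overlap c d).
Proof.
apply: chart_image_open; apply: open_comp; last exact: chart_dom_open.
by have [cf _] := f_smooth; move=> w _; exact: cf.
Qed.

Let overlap_smooth c d : charts A c -> charts (sphere_atlas R n) d ->
  smooth_on (overlap c d) (d \o f \o chart_inv c).
Proof. by have [_] := f_smooth; apply. Qed.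

(** The Euclidean coordinates of [f] are recovered from its chart expression by
    a smooth map, so a vector killed by the Jacobian in the charts is killed by
    the Jacobian of the coordinates. *)
Let overlap_unit c d u : charts A c -> charts (sphere_atlas R n) d ->
  overlap c d u -> pjacobian (d \o f \o chart_inv c) u \in unitmx.
Proof.
move=> Ac Sd; have sF := overlap_smooth Ac Sd; case: Sd sF => b _ <- sF ou.
have [p [cp dp] pu] := ou.
rewrite -row_free_unit; apply: inj_row_free => w wJ.
apply: (f_immersive Ac cp); rewrite pu.
pose F := stereo_chart n b \o f \o chart_inv c.
rewrite (@eq_pjacobian _ _ _ _ _ (@stereo_inv_fun R n b \o F) u (@overlap_open c _) ou).
  rewrite (is_diff_pjacobian (@pjacobian_comp _ _ _ _ _ setT F _ u (@overlap_open c _)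
    openT (sF 1%N) (@stereo_inv_smooth R n b 1%N) ou I)).
  by rewrite mulmxA wJ mul0mx.
move=> _ [q [cq dq] <-]; rewrite /F /= chart_funK//.
by have := chart_funK dq => /(congr1 val) /= ->.
Qed.

Lemma immersive_open (z : M) (W : set M) : nbhs z W -> nbhs (f z) (f @` W).
Proof.
move=> zW; have [c Ac cz] := charts_cover A z.
have [d Sd dz] := charts_cover (sphere_atlas R n) (f z).
have oz : overlap c d (c z) by exists z.
have rz : (c @` chart_dom c) (c z) by exists z.
have N1 : nbhs (c z) (overlap c d `&` chart_inv c @^-1` W).
  apply: (@filterI _ (nbhs (c z))).
    by apply: open_nbhs_nbhs; split => //; exact: overlap_open.
  by apply: (chart_inv_cont rz); rewrite chart_funK.
have := local_surj (@overlap_open c d) (overlap_smooth Ac Sd 1%N) oz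
  (overlap_unit Ac Sd oz) N1.
rewrite /= chart_funK// => N2.
have N3 : nbhs (f z) (d @^-1` ((d \o f \o chart_inv c) @`
    (overlap c d `&` chart_inv c @^-1` W))) by exact: (chart_fun_cont dz).
have N4 : nbhs (f z) (chart_dom d).
  by apply: open_nbhs_nbhs; split => //; exact: chart_dom_open.
apply: filterS (filterI N3 N4) => y [[_ [[p [cp dp] <-] Wp]] /= + dy].
rewrite /= chart_funK// in Wp * => dpy.
by exists p => //; rewrite -(chart_funK dy) -dpy chart_funK.
Qed.

Lemma immersive_locally_injective (z : M) :
  exists2 W, nbhs z W & forall v w, W v -> W w -> f v = f w -> v = w.
Proof.
have [c Ac cz] := charts_cover A z.
have [d Sd dz] := charts_cover (sphere_atlas R n) (f z).
have oz : overlap c d (c z) by exists z.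
have [W Wz Winj] := local_inj (@overlap_open c d) (overlap_smooth Ac Sd 1%N) oz
  (overlap_unit Ac Sd oz).
exists (chart_dom c `&` c @^-1` W).
  apply: filterI; last exact: (chart_fun_cont cz).
  by apply: open_nbhs_nbhs; split => //; exact: chart_dom_open.
move=> v w [cv Wv] [cw Ww] fvw.
rewrite -(chart_funK cv) -(chart_funK cw); congr (chart_inv c _).
by apply: Winj => //; rewrite /= !chart_funK// fvw.
Qed.

Lemma immersive_bijection_diffeomorphic (z0 : M) :
  (forall v w, f v = f w -> v = w) -> (forall y, exists z, f z = y) ->
  diffeomorphic A (sphere_atlas R n).
Proof.
move=> finj fsurj; pose g y := xget z0 [set z | f z = y].
have gK : cancel g f.
  by move=> y; have [z fz] := fsurj y; exact: (@xgetI _ z0 [set z | f z = y] z fz).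
have fK : cancel f g by move=> z; apply: finj; rewrite gK.
exists f, g; split => //; split.
  move=> y N gN; rewrite -[y]gK; apply: filterS (immersive_open gN) => _ [w Nw <-].
  by rewrite /= fK.
move=> d c Sd Ac.
have -> : d @` (chart_dom d `&` g @^-1` chart_dom c) =
    (d \o f \o chart_inv c) @` overlap c d.
  apply/seteqP; split.
    move=> _ [y [dy cgy] <-]; exists (c (g y)); last by rewrite /= chart_funK// gK.
    by exists (g y) => //; split => //=; rewrite gK.
  move=> _ [_ [p [cp dp] <-] <-]; exists (f p); last by rewrite /= chart_funK.
  by split => //=; rewrite fK.
have GF u : overlap c d u ->
    (c \o g \o chart_inv d) ((d \o f \o chart_inv c) u) = u.
  by move=> [p [cp dp] <-]; rewrite /= !chart_funK// fK.
by have [] := inverse_smooth (@overlap_open c d) (overlap_smooth Ac Sd)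
  (fun u => overlap_unit Ac Sd) GF.
Qed.

End local_diffeomorphism.

Theorem immersive_to_sphere_diffeomorphic (R : realType) (n : nat)
    (M : topologicalType) (A : atlas R n M) (f : M -> sphere R n) (z0 : M) :
  (2 <= n)%N -> hausdorff_space M -> compact [set: M] -> connected [set: M] ->
  smooth_map A (sphere_atlas R n) f -> immersive_to_sphere A f ->
  diffeomorphic A (sphere_atlas R n).
Proof.
move=> n2 hM kM cM sf If.
have [cf _] := sf.
have fo := immersive_open sf If; have fl := immersive_locally_injective sf If.
apply: (immersive_bijection_diffeomorphic sf If z0).
  exact: (sphere_cover_injective n2 hM kM cM cf fo fl).
exact: (sphere_cover_surjective n2 kM cf fo z0).
Qed.

(** * Inner products and the linear algebra of the Gauss map *)

Section inner_product.
Context {R : realType}.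

Lemma dotrE q (u v : 'rV[R]_q) : dotr u v = (u *m v^T) 0 0.
Proof. by rewrite mxE; apply: eq_bigr => j _; rewrite mxE. Qed.

Lemma mulmx_tr q (u v : 'rV[R]_q) : u *m v^T = (dotr u v)%:M.
Proof. by rewrite [LHS]mx11_scalar dotrE. Qed.

Lemma dotrC q (u v : 'rV[R]_q) : dotr u v = dotr v u.
Proof. by apply: eq_bigr => j _; rewrite mulrC. Qed.

Lemma dotrDl q (u v w : 'rV[R]_q) : dotr (u + v) w = dotr u w + dotr v w.
Proof. by rewrite !dotrE mulmxDl mxE. Qed.

Lemma dotrDr q (u v w : 'rV[R]_q) : dotr u (v + w) = dotr u v + dotr u w.
Proof. by rewrite ![dotr u _]dotrC dotrDl. Qed.

Lemma dotrZl q a (u v : 'rV[R]_q) : dotr (a *: u) v = a * dotr u v.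
Proof. by rewrite !dotrE -scalemxAl mxE. Qed.

Lemma dotrZr q a (u v : 'rV[R]_q) : dotr u (a *: v) = a * dotr u v.
Proof. by rewrite ![dotr u _]dotrC dotrZl. Qed.

Lemma dotrNl q (u v : 'rV[R]_q) : dotr (- u) v = - dotr u v.
Proof. by rewrite -scaleN1r dotrZl mulN1r. Qed.

Lemma dotrNr q (u v : 'rV[R]_q) : dotr u (- v) = - dotr u v.
Proof. by rewrite ![dotr u _]dotrC dotrNl. Qed.

Definition dotr_lin := (dotrDl, dotrDr, dotrNl, dotrNr, @dotrZl, @dotrZr).

Lemma dotr_unit_bounds q (u v : 'rV[R]_q) : dotr u u = 1 -> dotr v v = 1 ->
  -1 <= dotr u v <= 1.
Proof.
move=> u1 v1; have := dotr_ge0 (u + v); have := dotr_ge0 (u - v).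
by rewrite !dotr_lin u1 v1 (dotrC v u) => h1 h2; apply/andP; split; lra.
Qed.

(** The residue of [y] after projection on [p] and [z] has a nonnegative
    squared norm. *)
Lemma bessel q (y p z : 'rV[R]_q) : dotr y y = 1 -> dotr p p = 1 ->
  dotr z z = 1 -> dotr z p = 0 -> dotr y z ^+ 2 <= 1 - dotr y p ^+ 2.
Proof.
move=> y1 p1 z1 zp; have := dotr_ge0 (y - dotr y p *: p - dotr y z *: z).
rewrite !dotr_lin y1 p1 z1 (dotrC p z) zp (dotrC p y) (dotrC z y).
move=> h; rewrite -subr_ge0; apply: le_trans h _.
by rewrite le_eqVlt; apply/orP; left; apply/eqP; ring.
Qed.

(** The Householder reflection that sends [p] to plus or minus the first basis
    vector is symmetric and involutive, its first row is plus or minus [p], and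
    the other rows form the required basis. The sign [s] is chosen so that the
    vector [p - s e] defining the reflection is nonzero. *)
Lemma orthonormal_complement q (p : 'rV[R]_q.+1) : dotr p p = 1 ->
  exists Q : 'M[R]_(q, q.+1),
    [/\ Q *m Q^T = 1%:M, p *m Q^T = 0 & Q^T *m Q = 1%:M - p^T *m p].
Proof.
move=> p1; pose s : R := if p 0 0 == 1 then -1 else 1.
have s2 : s * s = 1 by rewrite /s; case: ifP; rewrite ?mulrNN mulr1.
have ps : p 0 0 - s != 0.
  rewrite /s; case: ifP => [/eqP ->|/negbT]; last by rewrite subr_eq0.
  by rewrite opprK; apply: lt0r_neq0; lra.
pose e : 'rV[R]_q.+1 := delta_mx 0 0.
pose v : 'rV[R]_q.+1 := p - s *: e.
have ee : dotr e e = 1.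
  by rewrite /dotr big_ord_recl big1 ?mxE ?mulr1 ?addr0// => i _; rewrite !mxE mulr0.
have pe : dotr p e = p 0 0.
  rewrite /dotr big_ord_recl big1 ?mxE ?mulr1 ?addr0// => i _.
  by rewrite !mxE mulr0.
have vv : dotr v v = - 2 * s * (p 0 0 - s).
  rewrite !dotr_lin p1 ee (dotrC e p) pe.
  by lra.
have s0 : s != 0 by apply/eqP => s0; move/eqP: s2; rewrite s0 mulr0 eq_sym oner_eq0.
have vv0 : dotr v v != 0 by rewrite vv !mulf_neq0// oppr_eq0 pnatr_eq0.
pose a := 2 / dotr v v; pose Z := v^T *m v.
have ZZ : Z *m Z = dotr v v *: Z.
  by rewrite /Z mulmxA -[v^T *m v *m v^T]mulmxA mulmx_tr mul_mx_scalar -scalemxAl.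
pose H : 'M[R]_(1 + q) := 1%:M - a *: Z.
have HT : H^T = H by rewrite /H linearB /= linearZ /= tr_scalar_mx trmx_mul trmxK.
have HH : H *m H = 1%:M.
  rewrite /H mulmxBl mul1mx mulmxBr mulmx1 -scalemxAl -scalemxAr ZZ !scalerA.
  have -> : a * a * dotr v v = a + a by rewrite /a; field.
  rewrite scalerDl; move: (a *: Z) => X.
  by apply/matrixP => i j; rewrite !mxE; ring.
have v0 : v 0 0 = p 0 0 - s by rewrite !mxE mulr1.
(* [dotr v v] is [- 2 s v_0], so the first row of [H] is [e + s v = s p]. *)
have av0 : a * v 0 0 = - s.
  have sV : s^-1 = s by apply: (mulfI s0); rewrite mulfV.
  rewrite /a vv v0 -[in RHS]sV; field.
  by rewrite s0 ps.
have Hu : usubmx H = s *: (p : 'rV[R]_(1 + q)).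
  apply/rowP => j; rewrite !mxE big_ord1 !mxE.
  have -> : lshift q 0 = 0 :> 'I_(1 + q) by apply/val_inj.
  rewrite mulrA (_ : p 0 0 - s * _ = v 0 0); last by rewrite !mxE.
  rewrite av0 mulNr opprK mulrBr mulrA s2 mul1r eqxx /=.
  by rewrite [j == 0]eq_sym addrCA subrr addr0.
pose Q := dsubmx H.
have HE : H = col_mx (s *: (p : 'rV[R]_(1 + q))) Q by rewrite -Hu vsubmxK.
have [pQ QQ] : (s *: (p : 'rV[R]_(1 + q))) *m Q^T = 0 /\ Q *m Q^T = 1%:M.
  have := HH; rewrite -[X in _ *m X]HT HE tr_col_mx mul_col_row.
  by rewrite (scalar_mx_block 1 q 1) => /eq_block_mx[_ -> _ ->].
have HTH : (s *: (p : 'rV[R]_(1 + q)))^T *m (s *: p) + Q^T *m Q = 1%:M.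
  by have := HH; rewrite -[X in X *m _]HT HE tr_col_mx mul_row_col.
exists Q.
split => //.
  have := congr1 ( *:%R s) pQ; rewrite -scalemxAl scalerA s2 scale1r scaler0.
  by [].
apply: (canRL (addrK _)); rewrite addrC -[RHS]HTH.
by rewrite -scalemxAr [X in _ *: (X *m _)]linearZ /= -scalemxAl scalerA s2 scale1r.
Qed.

End inner_product.

Section gauss_map_derivative.
Context {R : realType}.

(** The Weingarten equation [d eta = - A dx]. It requires that the rows of [JE]
    be combinations of those of [JX]: both are orthogonal to the independent
    vectors [x] and [e], and the [n] independent rows of [JX] span the orthogonal
    complement of the latter. *)
Lemma weingarten n (x e : 'rV[R]_n.+2) (JX JE : 'M[R]_(n, n.+2)) :
  dotr x x = 1 -> dotr e e = 1 -> dotr x e = 0 ->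
  JX *m x^T = 0 -> JX *m e^T = 0 -> JE *m x^T = 0 -> JE *m e^T = 0 ->
  row_free JX ->
  - (- (JE *m (1%:M - x^T *m x)) *m pinvmx JX) *m JX = JE.
Proof.
move=> x1 e1 xe JXx JXe JEx JEe fJX.
have -> : JE *m (1%:M - x^T *m x) = JE.
  by rewrite mulmxBr mulmx1 mulmxA JEx mul0mx subr0.
rewrite !mulNmx opprK mulmxKpV//.
(* The row space of [JX] is the whole orthogonal complement of [x] and [e], by
   comparison of the ranks. *)
pose K : 'M[R]_(1 + 1, n.+2) := col_mx x e.
have KK : K *m K^T = 1%:M.
  rewrite /K tr_col_mx mul_col_row !mulmx_tr x1 e1 xe (dotrC e x) xe.
  by rewrite !raddf0 -(scalar_mx_block 1 1 1).
have KT (J : 'M[R]_(n, n.+2)) : J *m x^T = 0 -> J *m e^T = 0 -> (J <= kermx K^T)%MS.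
  by move=> Jx Je; apply/sub_kermxP; rewrite tr_col_mx mul_mx_row Jx Je row_mx0.
have rK : \rank K^T = 2%N.
  by rewrite mxrank_tr; apply/eqP; apply/row_freeP; exists K^T.
have JXK := KT JX JXx JXe.
have eqK : (kermx K^T <= JX)%MS.
  rewrite -(mxrank_leqif_sup JXK) mxrank_ker rK.
  by rewrite (eqP fJX) subSS subSS subn0.
exact: submx_trans (KT JE JEx JEe) eqK.
Qed.

(** The matrix is the derivative of [e - mu (x + p)]. The inner product with [x]
    of the image of [w] is [- (1 + <x, p>) (w dmu)], so [w dmu = 0]. What remains
    is [w (A + mu) dx = 0] up to sign, hence [w (A + mu) = 0], while [- mu] is
    not an eigenvalue of [A]. *)
Lemma gauss_derivative_injective n (x e p : 'rV[R]_n.+2) (JX JE : 'M[R]_(n, n.+2))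
    (dmu : 'cV[R]_n) (mu : R) (l : 'I_n -> R) :
  dotr x x = 1 -> dotr e e = 1 -> dotr x e = 0 ->
  JX *m x^T = 0 -> JX *m e^T = 0 -> JE *m x^T = 0 -> JE *m e^T = 0 ->
  row_free JX ->
  char_poly (- (JE *m (1%:M - x^T *m x)) *m pinvmx JX) = \prod_i ('X - (l i)%:P) ->
  (forall i, l i != - mu) -> 1 + dotr x p != 0 ->
  forall w : 'rV[R]_n, w *m (JE - dmu *m (x + p) - mu *: JX) = 0 -> w = 0.
Proof.
move=> x1 e1 xe JXx JXe JEx JEe fJX cp lmu xp w wJ.
have W := weingarten x1 e1 xe JXx JXe JEx JEe fJX.
set S := - (JE *m _) *m _ in cp W.
have wd : w *m dmu = 0.
  have := congr1 (mulmx^~ x^T) wJ; rewrite /= mul0mx !mulmxBr !mulmxBl.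
  rewrite -[w *m JE *m _]mulmxA JEx mulmx0 -scalemxAr -scalemxAl -mulmxA.
  rewrite -[w *m JX *m _]mulmxA JXx mulmx0 scaler0 subr0 sub0r -mulmxA.
  rewrite mulmx_tr dotrDl x1 (dotrC p x) mulmxA mul_mx_scalar => /eqP.
  by rewrite oppr_eq0 scaler_eq0 (negbTE xp) /= => /eqP.
have {}wJ : w *m (S + mu%:M) = 0.
  apply: (row_free_inj fJX); rewrite mul0mx -mulmxA mulmxDl mul_scalar_mx.
  have -> : S *m JX = - JE by rewrite -[in RHS]W mulNmx opprK.
  have := wJ; rewrite !mulmxBr mulmxA wd mul0mx subr0 => h.
  by rewrite mulmxDr mulmxN addrC -opprB h oppr0.
apply/eqP; apply: contraT => w0.
have : eigenvalue S (- mu).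
  apply/eigenvalueP; exists w => //.
  move: wJ; rewrite mulmxDr mul_mx_scalar => /eqP; rewrite addr_eq0 => /eqP ->.
  by rewrite scaleNr.
rewrite eigenvalue_root_char cp => /rootP; rewrite horner_prod => /eqP /prodf_eq0[i _].
by rewrite hornerXsubC subr_eq0 eq_sym (negbTE (lmu i)).
Qed.

End gauss_map_derivative.

(** * Derivative of the Gauss map and the curvature bound *)

Section derivative_formulas.
Context {R : realType}.

Lemma dotr_const_pjacobian m q (U : set 'rV[R]_m)
    (F G : 'rV[R]_m -> 'rV[R]_q) u (a : R) :
  open U -> smooth_on U F -> smooth_on U G -> U u ->
  (forall v, U v -> dotr (F v) (G v) = a) ->
  pjacobian F u *m (G u)^T + pjacobian G u *m (F u)^T = 0.
Proof.
move=> oU sF sG Uu FG; apply/matrixP => i j; rewrite ord1 {j}.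
have dF k : derivable (fun v => F v 0 k) u (delta_mx 0 i).
  by have [_ d] := sF 1%N k; have [+ _] := d i; apply.
have dG k : derivable (fun v => G v 0 k) u (delta_mx 0 i).
  by have [_ d] := sG 1%N k; have [+ _] := d i; apply.
pose h k : 'rV[R]_m -> R := (fun v => F v 0 k) * (fun v => G v 0 k).
have : 'D_(delta_mx 0 i) (\sum_k h k) u = 0.
  rewrite -(derive_cst a u (delta_mx 0 i)); apply: near_eq_derive.
  apply: filterS (open_nbhs_nbhs (conj oU Uu)) => v /FG <-.
  by rewrite fct_sumE.
rewrite derive_sum => [|k]; last by apply: derivableM; [exact: dF|exact: dG].
move=> h0; rewrite [RHS]mxE -h0 !mxE -big_split /=; apply: eq_bigr => k _.
rewrite deriveM//= !mxE addrC; congr (_ + _); exact: mulrC.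
Qed.

Lemma reflected_normal_pjacobian m q (U : set 'rV[R]_m) (X E : 'rV[R]_m -> 'rV[R]_q)
    (mu : 'rV[R]_m -> R) (P : 'rV[R]_q) u :
  open U -> smooth_on U X -> smooth_on U E -> Ck 1 U mu -> U u ->
  pjacobian (fun v => E v - mu v *: (X v + P)) u =
  pjacobian E u - (\col_i 'D_(delta_mx 0 i) mu u) *m (X u + P) - mu u *: pjacobian X u.
Proof.
move=> oU sX sE smu Uu; apply/matrixP => i j.
have dX : derivable (fun v => X v 0 j) u (delta_mx 0 i).
  by have [_ d] := sX 1%N j; have [+ _] := d i; apply.
have dE : derivable (fun v => E v 0 j) u (delta_mx 0 i).
  by have [_ d] := sE 1%N j; have [+ _] := d i; apply.
have dmu : derivable mu u (delta_mx 0 i).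
  by have [_ d] := smu; have [+ _] := d i; apply.
rewrite mxE.
have -> : (fun v => (E v - mu v *: (X v + P)) 0 j) =
    (fun v => E v 0 j) - mu * ((fun v => X v 0 j) + cst (P 0 j)).
  by apply/funext => v; rewrite !mxE.
have dXP : derivable ((fun v => X v 0 j) + cst (P 0 j)) u (delta_mx 0 i).
  by apply: derivableD => //; exact: derivable_cst.
rewrite (deriveB dE (derivableM dmu dXP)) (deriveM dmu dXP).
rewrite (deriveD dX (derivable_cst _ _ _)).
rewrite derive_cst addr0 !mxE big_ord1 !mxE.
rewrite -[in RHS]addrA; congr (_ + _); rewrite opprD [LHS]addrC; congr (- _ + - _).
by rewrite /= mulrC.
Qed.

Lemma smooth_on_reflected_normal m q (U : set 'rV[R]_m) (X E : 'rV[R]_m -> 'rV[R]_q)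
    (mu : 'rV[R]_m -> R) (P : 'rV[R]_q) :
  open U -> smooth_on U X -> smooth_on U E -> (forall k, Ck k U mu) ->
  smooth_on U (fun v => E v - mu v *: (X v + P)).
Proof.
move=> oU sX sE smu k j.
apply: (eq_Ck oU (f := fun v => E v 0 j + -1 * (mu v * (X v 0 j + P 0 j)))) => [v _|].
  by rewrite !mxE mulN1r.
apply: CkD; [exact: oU|exact: sE|].
apply: CkM; [exact: oU|exact: Ck_cst|].
apply: CkM; [exact: oU|exact: smu|].
by apply: CkD; [exact: oU|exact: sX|exact: Ck_cst].
Qed.

Lemma Ck_dotr_cst k m q (U : set 'rV[R]_m) (F : 'rV[R]_m -> 'rV[R]_q) (P : 'rV[R]_q) :
  open U -> smooth_on U F -> Ck k U (fun v => dotr (F v) P).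
Proof.
move=> oU sF; apply: Ck_sum => [|j]; first exact: oU.
by apply: CkM; [exact: oU|exact: sF|exact: Ck_cst].
Qed.

End derivative_formulas.

Section spherical_bounds.
Context {R : realType}.

Lemma sphere_dotr q (y : sphere R q) : dotr (val y) (val y) = 1.
Proof. exact: (set_mem (valP y)). Qed.

Lemma ball_dotr q (p y : sphere R q) (r : R) : 0 < r < pi ->
  geodesic_ball p r y -> cos r <= dotr (val y) (val p).
Proof.
move=> /andP[r0 rpi]; rewrite /geodesic_ball /= /sdist => yr.
have /acos_def[/andP[a0 api] ca] := dotr_unit_bounds (sphere_dotr y) (sphere_dotr p).
rewrite -[leRHS]ca leNgt ltr_cos ?in_itv /= ?a0 ?api ?(ltW r0) ?(ltW rpi)//.
by rewrite -leNgt.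
Qed.

(** If [a = <y, p>] had [|a| > sin L], then by Bessel's inequality all the
    points [z] of the equator would satisfy
    [<y, z> <= sqrt (1 - a^2) < cos L], and would be at a distance from [y]
    bounded below by a constant larger than [L]. The equator has to be nonempty,
    as the infimum of the empty set is 0. *)
Lemma strip_dotr q (p y : sphere R q.+1) (L : R) : 0 <= L <= pi / 2 ->
  strip p L y -> `|dotr (val y) (val p)| <= sin L.
Proof.
move=> /andP[L0 Lpi]; rewrite /strip /=; set a := dotr _ _ => yL.
have pi0 := @pi_ge0 R.
have LI : L \in `[0, pi]%R by rewrite in_itv /= L0; lra.
have sL : 0 <= sin L by rewrite sin_ge0_pi// L0; lra.
have cL : 0 <= cos L by rewrite cos_ge0_pihalf// Lpi andbT; lra.
suff H : a ^+ 2 <= sin L ^+ 2.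
  by rewrite -(@ler_pXn2r _ 2)// ?nnegrE// real_normK ?num_real.
have a1 : a ^+ 2 <= 1.
  have /andP[h1 h2] := dotr_unit_bounds (sphere_dotr y) (sphere_dotr p).
  by rewrite -real_normK ?num_real// expr_le1// ler_norml h1.
rewrite sin2cos2 lerBrDl -lerBrDr leNgt; apply/negP => aL.
pose s := Num.sqrt (1 - a ^+ 2).
have s0 : 0 <= s by exact: sqrtr_ge0.
have sc : s < cos L.
  by rewrite -(@ltr_pXn2r _ 2)// ?nnegrE// sqr_sqrtr// subr_ge0.
have s1 : -1 <= s <= 1.
  by rewrite (le_trans _ s0) ?lerN10//= (le_trans (ltW sc))// cos_le1.
have /acos_def[/andP[as0 aspi] cas] := s1.
have sI : acos s \in `[0, pi]%R by rewrite in_itv /= as0.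
have Ls : L < acos s by rewrite -ltr_cos// cas.
suff : acos s <= sdist_set y (equator p).
  by move=> /le_trans /(_ yL); rewrite leNgt Ls.
apply: lb_le_inf.
  have [Q [QQ pQ _]] := orthonormal_complement (sphere_dotr p).
  have z1 : dotr (row 0 Q) (row 0 Q) = 1.
    transitivity ((Q *m Q^T) 0 0); last by rewrite QQ mxE eqxx.
    by rewrite mxE; apply: eq_bigr => j _; rewrite !mxE.
  have zs : row 0 Q \in sphere R q.+1 by apply/mem_set.
  exists (sdist y (exist _ (row 0 Q) zs)); exists (exist _ (row 0 Q) zs) => //.
  rewrite /equator /= dotrC.
  transitivity ((val p *m Q^T) 0 0); last by rewrite pQ mxE.
  by rewrite mxE; apply: eq_bigr => j _; rewrite !mxE.
move=> _ [z zp <-]; rewrite /sdist.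
have /acos_def[/andP[b0 bpi] cb] := dotr_unit_bounds (sphere_dotr y) (sphere_dotr z).
rewrite leNgt -ltr_cos ?in_itv /= ?b0 ?as0// cas cb -leNgt.
have B : dotr (val y) (val z) ^+ 2 <= 1 - a ^+ 2.
  exact: (bessel (sphere_dotr y) (sphere_dotr p) (sphere_dotr z) zp).
apply: le_trans (ler_norm _) _; rewrite -sqrtr_sqr.
by rewrite ler_sqrt// subr_ge0.
Qed.

End spherical_bounds.

Section conformal_gauss_map.
Context {R : realType} {q : nat}.
Implicit Types x e p : 'rV[R]_q.

(** The amount by which stereographic projection from [- p] shifts the principal
    curvatures of a hypersurface at [x] with normal [e]. *)
Definition tilt x e p : R := dotr e p / (1 + dotr x p).

(** The reflection exchanging [x] and [- p], applied to [e] orthogonal to [x].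
    This is the unit normal at the image of [x] of the hypersurface projected
    stereographically from [- p]. *)
Definition reflected_normal x e p : 'rV[R]_q := e - tilt x e p *: (x + p).

Lemma reflected_normal_dotr x e p : dotr p p = 1 -> 1 + dotr x p != 0 ->
  dotr (reflected_normal x e p) p = 0.
Proof.
move=> p1 xp; rewrite /reflected_normal /tilt !dotr_lin p1 addrC.
by rewrite [_ + 1]addrC divfK// addrC subrr.
Qed.

Lemma reflected_normal_unit x e p : dotr x x = 1 -> dotr e e = 1 ->
  dotr p p = 1 -> dotr e x = 0 -> 1 + dotr x p != 0 ->
  dotr (reflected_normal x e p) (reflected_normal x e p) = 1.
Proof.
move=> x1 e1 p1 ex xp; rewrite /reflected_normal /tilt !dotr_lin.
rewrite x1 e1 p1 (dotrC x e) (dotrC p e) (dotrC p x) ex.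
by field.
Qed.

End conformal_gauss_map.

(** * The sphere theorem *)

Theorem theorem3 (R : realType) (n : nat) (M : topologicalType)
    (A : atlas R n M) (x eta : M -> sphere R n.+1) (p0 : sphere R n.+1)
    (L r : R) (lambda : 'I_n -> M -> R)
    (n_ge2 : (2 <= n)%N)
    (M_hausdorff : hausdorff_space M)
    (M_second_countable : @second_countable M)
    (M_compact : compact [set: M])
    (M_connected : connected [set: M])
    (x_immersion : immersion A x)
    (eta_normal : unit_normal A x eta)
    (L_range : 0 <= L <= pi / 2)
    (eta_strip : forall p, strip p0 L (eta p))
    (r_range : 0 < r < pi)
    (x_ball : forall p, geodesic_ball p0 r (x p))
    (lambda_principal :
      forall p, principal_curvatures A x eta p (fun i => lambda i p))
    (lambda_bound : forall i : 'I_n,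
      inf [set `|lambda i p| | p in [set: M]] > sin L / (1 + cos r)) :
  diffeomorphic A (sphere_atlas R n).
Proof.
have r_cos : 0 < 1 + cos r.
  have /andP[r0 rpi] := r_range.
  have : cos pi < cos r by rewrite ltr_cos// in_itv /= ?pi_ge0 ?lexx// !ltW.
  by rewrite cospi; lra.
have L_sin : 0 <= sin L.
  have /andP[L0 Lpi] := L_range; have := @pi_ge0 R => pi0.
  by rewrite sin_ge0_pi// L0; lra.
(* On the empty manifold the infimum of the curvatures would be 0. *)
have [p1 _] : [set: M] !=set0.
  apply: contrapT => /nonemptyPn M0; have := lambda_bound (Ordinal (ltnW n_ge2)).
  rewrite M0 image_set0 inf0; apply/negP; rewrite -leNgt.
  by rewrite divr_ge0// ltW.
have [x_smooth x_free] := x_immersion.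
have [eta_smooth eta_x eta_dx] := eta_normal.
pose P : 'rV[R]_n.+2 := val p0; have P1 : dotr P P = 1 := sphere_dotr p0.
have [Q [_ _ QTQ]] := orthonormal_complement P1.
have xP p : cos r <= dotr (val (x p)) P by exact: ball_dotr (x_ball p).
have xP0 p : 1 + dotr (val (x p)) P != 0.
  by apply: lt0r_neq0; have := xP p; lra.
pose mu p := tilt (val (x p)) (val (eta p)) P.
have mu_le p : `|mu p| <= sin L / (1 + cos r).
  rewrite /mu /tilt normrM normfV ler_pM ?invr_ge0//.
    exact: strip_dotr (eta_strip p).
  have xPp := xP p; rewrite ger0_norm; last by lra.
  by rewrite lef_pV2 ?posrE; lra.
pose N p := reflected_normal (val (x p)) (val (eta p)) P.
have NP p : dotr (N p) P = 0 by exact: reflected_normal_dotr.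
have N1 p : dotr (N p) (N p) = 1.
  by apply: reflected_normal_unit => //; exact: sphere_dotr.
have NQ p : N p *m Q^T *m Q = N p.
  by rewrite -mulmxA QTQ mulmxBr mulmx1 mulmxA mulmx_tr NP raddf0 mul0mx subr0.
have fs p : N p *m Q^T \in sphere R n.
  apply/mem_set; rewrite /sphere /= dotrE trmx_mul trmxK mulmxA NQ.
  by rewrite mulmx_tr N1 mxE.
pose f p : sphere R n := exist _ (N p *m Q^T) (fs p).
pose X (c : @chart R n M) u : 'rV[R]_n.+2 := val (x (chart_inv c u)).
pose E (c : @chart R n M) u : 'rV[R]_n.+2 := val (eta (chart_inv c u)).
pose U (c : @chart R n M) := c @` chart_dom c.
have oU c : open (U c) by exact: chart_range_open.
have sX c : charts A c -> smooth_on (U c) (X c) by exact: sphere_chart_smooth.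
have sE c : charts A c -> smooth_on (U c) (E c) by exact: sphere_chart_smooth.
have smu c k : charts A c -> Ck k (U c) (mu \o chart_inv c).
  move=> Ac; apply: CkM; [exact: oU|exact: Ck_dotr_cst (sE c Ac)|].
  apply: CkV; [exact: oU|by move=> u _; exact: xP0|].
  apply: CkD; [exact: oU|exact: Ck_cst|exact: Ck_dotr_cst (sX c Ac)].
have sN c : charts A c -> smooth_on (U c) (fun u => N (chart_inv c u)).
  move=> Ac; apply: (smooth_on_reflected_normal _ (oU c) (sX c Ac) (sE c Ac)).
  by move=> k; exact: smu.
have sf c : charts A c -> smooth_on (U c) (fun u => N (chart_inv c u) *m Q^T).
  by move=> Ac; apply: smooth_on_mulmxr; [exact: oU|exact: sN].
apply: (@immersive_to_sphere_diffeomorphic R n M A f p1) => //.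
  by apply: smooth_map_sphere => c Ac; exact: sf.
move=> c p Ac cp w wf.
have Uc : U c (c p) by exists p.
(* [N] is recovered from its coordinates in the basis [Q]. *)
have wN : w *m pjacobian (fun u => N (chart_inv c u)) (c p) = 0.
  rewrite (_ : (fun u => N (chart_inv c u)) =
               (fun u => N (chart_inv c u) *m Q^T *m Q)); last first.
    by apply/funext => u; rewrite NQ.
  by rewrite (pjacobian_mulmxr Q (oU c) (sf c Ac) Uc) mulmxA wf mul0mx.
have jac h : smooth_on (U c) (fun u => h (chart_inv c u)) ->
    chart_jacobian c h p = pjacobian (fun u => h (chart_inv c u)) (c p).
  move=> sh; rewrite /chart_jacobian jacobianE//.
  by have [] := C1_is_diff (oU c) (sh 1%N) Uc.
have JX := jac _ (val \o x) (sX c Ac); have JE := jac _ (val \o eta) (sE c Ac).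
have Xp : X c (c p) = val (x p) by rewrite /X chart_funK.
have Ep : E c (c p) = val (eta p) by rewrite /E chart_funK.
have XX := dotr_const_pjacobian (oU c) (sX c Ac) (sX c Ac) Uc
  (fun u _ => sphere_dotr (x (chart_inv c u))).
have EE := dotr_const_pjacobian (oU c) (sE c Ac) (sE c Ac) Uc
  (fun u _ => sphere_dotr (eta (chart_inv c u))).
have EX := dotr_const_pjacobian (oU c) (sE c Ac) (sX c Ac) Uc
  (fun u _ => eta_x (chart_inv c u)).
have half (B : 'cV[R]_n) : B + B = 0 -> B = 0.
  move=> BB; apply/matrixP => i j; have /matrixP/(_ i j) := BB.
  by rewrite !mxE => h; lra.
have JXE : pjacobian (X c) (c p) *m (E c (c p))^T = 0.
  apply/matrixP => i j; rewrite ord1 [RHS]mxE -(eta_dx c p Ac cp i) JX Ep.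
  by rewrite mxE; apply: eq_bigr => k _; rewrite !mxE.
move: wN.
rewrite (reflected_normal_pjacobian _ (oU c) (sX c Ac) (sE c Ac) (smu c 1%N Ac) Uc).
apply: (@gauss_derivative_injective R n (X c (c p)) (E c (c p)) P _ _ _ _
   (fun i => lambda i p)).
- exact: sphere_dotr.
- exact: sphere_dotr.
- by rewrite dotrC; exact: eta_x.
- exact: half.
- exact: JXE.
- by move: EX; rewrite JXE addr0.
- exact: half.
- by have := x_free c p Ac cp; rewrite JX.
- have := lambda_principal p c Ac cp.
  by rewrite /shape_operator /covariant_derivative /tangent_proj JX JE -Xp.
- move=> i; apply/eqP => lmu.
  have : `|lambda i p| <= sin L / (1 + cos r).
    by rewrite lmu normrN; exact: mu_le.
  apply/negP; rewrite -ltNge; apply: lt_le_trans (lambda_bound i) _.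
  apply: ge_inf; last by exists p.
  by exists 0 => _ [z _ <-]; exact: normr_ge0.
- exact: xP0.
Qed.
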